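(* For $i=1,2$, let $G_i$ be a $k_i$-crossing-critical graph with a simple vertex $v_i\in V(G_i)$ of degree $d$. If $d\neq 3$, assume moreover that $v_i$ has a homogeneous neighborhood in $G_i$ for $i=1,2$. Let $k=\max\{\mathrm{cr}(G_1)+k_2,\ \mathrm{cr}(G_2)+k_1\}$ and let $G\in G_1\,{}_{v_1}\!\odot_{v_2}G_2$. If $\mathrm{cr}(G)\ge k$, then $G$ is $k$-crossing-critical.
   Context: Graphs may have multiple edges but no loops (and no vertices of degree two); $\mathrm{cr}$ denotes crossing number. A graph $G$ is $k$-crossing-critical if $\mathrm{cr}(G)\ge k$ and $\mathrm{cr}(G-e)<k$ for every edge $e$. A vertex is simple if it is not incident with multiple edges. For simple vertices $v_i\in V(G_i)$ of equal degree with neighbourhoods $N_i$ and a bijection $\sigma:N_1\to N_2$, the zip product $G_1\odot_\sigma G_2$ is obtained from the disjoint union of $G_1-v_1$ and $G_2-v_2$ by adding the edges $u\sigma(u)$, $u\in N_1$; $G_1\,{}_{v_1}\!\odot_{v_2}G_2$ is the set of all such graphs over all bijections $\sigma$. For $S\subseteq V(G)$, $\Gamma_G(S)$ denotes the pointwise stabilizer of $S$ in $\mathrm{Aut}(G)$; $S$ is $\Gamma$-homogeneous if every permutation of $S$ is the restriction of an automorphism in $\Gamma$; $v$ has a homogeneous neighborhood in $G$ if $N_G(v)$ is $\Gamma_G(\{v\})$-homogeneous. *)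

(* Defs.v *)
From mathcomp Require Import all_boot all_order all_algebra all_fingroup.
From mathcomp Require Import all_classical all_reals all_analysis.

Set Implicit Arguments.
Unset Strict Implicit.
Unset Printing Implicit Defensive.

Import Order.TTheory GRing.Theory Num.Theory.
Import numFieldNormedType.Exports.

Local Open Scope set_scope.

(* Loops are excluded because every edge has exactly two ends; multiple edges
   are distinct elements of [edge G] with the same pair of ends. *)
Record multigraph := Multigraph {
  vertex : finType;
  edge : finType;
  ends : edge -> {set vertex};
  card_ends : forall e, #|ends e| = 2 }.

Section Multigraph.
Variable G : multigraph.
Implicit Types (u v : vertex G) (e f : edge G).

Definition degree v : nat := #|[set e | v \in ends e]|.

Definition neighborhood v : {set vertex G} :=
  [set u | [exists e, ends e == [set u; v]]].

Definition simple_vertex v : Prop :=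
  forall e f, v \in ends e -> ends e = ends f -> e = f.

Definition no_degree_two : Prop := forall v, degree v <> 2.

Lemma card_ends_del_edge e (f : {f : edge G | f != e}) :
  #|ends (val f)| = 2.
Proof. exact: card_ends. Qed.

Definition del_edge e : multigraph :=
  @Multigraph (vertex G) {f | f != e}
    (fun f : {f | f != e} => ends (val f)) (@card_ends_del_edge e).

(* An automorphism of a multigraph is a pair of compatible permutations of the
   vertices and of the edges; only its action on the vertices is recorded. *)
Definition automorphisms : {set {perm vertex G}} :=
  [set s : {perm vertex G} |
    [exists t : {perm edge G}, forall e, ends (t e) == s @: ends e]].

Definition pointwise_stabilizer (S : {set vertex G}) : {set {perm vertex G}} :=
  'C_automorphisms(S | 'P)%g.

(* The permutations of S are represented by the permutations of all the
   vertices that have their support in S. *)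
Definition homogeneous (Gamma : {set {perm vertex G}}) (S : {set vertex G}) :
    Prop :=
  forall s : {perm vertex G}, perm_on S s ->
    exists2 g, g \in Gamma & {in S, g =1 s}.

Definition homogeneous_neighborhood v : Prop :=
  homogeneous (pointwise_stabilizer [set v]) (neighborhood v).

Lemma neighborhood_neq v u : u \in neighborhood v -> u != v.
Proof.
rewrite inE => /existsP[e /eqP euv]; apply/eqP => uv.
by have := card_ends e; rewrite euv uv finset.setUid cards1.
Qed.

End Multigraph.

Section ZipProduct.
Variables (G1 G2 : multigraph) (v1 : vertex G1) (v2 : vertex G2).
Variable sigma : {u | u \in neighborhood v1} -> {u | u \in neighborhood v2}.

Definition zip_vertex : finType :=
  ({u : vertex G1 | u != v1} + {u : vertex G2 | u != v2})%type.

(* Edges of G1 - v1, edges of G2 - v2, and one edge for each neighbour of v1. *)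
Definition zip_edge : finType :=
  ({e : edge G1 | v1 \notin ends e} + {e : edge G2 | v2 \notin ends e}
   + {u | u \in neighborhood v1})%type.

Definition zip_ends (e : zip_edge) : {set zip_vertex} :=
  match e with
  | inl (inl e1) => inl @: [set u | val u \in ends (val e1)]
  | inl (inr e2) => inr @: [set u | val u \in ends (val e2)]
  | inr u => [set inl (Sub (val u) (neighborhood_neq (valP u)));
                  inr (Sub (val (sigma u)) (neighborhood_neq (valP (sigma u))))]
  end.

Lemma card_zip_ends e : #|zip_ends e| = 2.
Proof.
have aux (G : multigraph) (v : vertex G) (f : edge G) : v \notin ends f ->
    #|[set u : {u : vertex G | u != v} | val u \in ends f]| = 2.
  move=> vf; rewrite -(card_ends f) -(card_imset _ val_inj).
  apply: eq_card => x; apply/imsetP/idP => [[u + ->]|xf]; first by rewrite inE.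
  have xv : x != v by apply: contraNneq vf => <-.
  by exists (Sub x xv); rewrite ?inE.
case: e => [[e|e]|u] /=; last by rewrite cards2.
  by rewrite card_imset ?aux ?(valP e) //; apply: inl_inj.
by rewrite card_imset ?aux ?(valP e) //; apply: inr_inj.
Qed.

Definition zip_product : multigraph := Multigraph card_zip_ends.

End ZipProduct.

Local Open Scope ring_scope.
Local Open Scope classical_set_scope.

(* [multigraph] is too large a type for [set multigraph]. *)
Definition zip_products (G1 G2 : multigraph) (v1 : vertex G1) (v2 : vertex G2)
    (G : multigraph) : Prop :=
  exists2 sigma : {u | u \in neighborhood v1} -> {u | u \in neighborhood v2},
    bijective sigma & G = zip_product sigma.

(* Edges are simple arcs that pass through no vertex except at their ends.
   Nothing else is required of how edges meet, see [crossings]. *)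
Record drawing (R : realType) (G : multigraph) := Drawing {
  position : vertex G -> R * R;
  curve : edge G -> R -> R * R;
  position_inj : injective position;
  curve_continuous : forall e, {within `[0, 1], continuous (curve e)};
  curve_inj : forall e, {in `[0, 1] &, injective (curve e)};
  curve_ends : forall e,
    [set curve e 0; curve e 1] = position @` [set` ends e];
  curve_avoid : forall e v (t : R), t \in `]0, 1[ -> curve e t <> position v }.

(* The pairwise intersections of edges: pairs of an unordered pair of distinct
   edges and a point common to their interiors.  A point where edges merely
   touch is counted, and a point interior to m edges is counted m(m-1)/2 times,
   so that drawings with touchings or multiple crossings, which can be
   perturbed away without increasing the count, do not affect the minimum. *)
Definition crossings (R : realType) (G : multigraph) (D : drawing R G) :
    set ({set edge G} * (R * R)) :=
  [set c | exists e f, [/\ e != f, c.1 = [set e; f]%SET,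
                           (curve D e @` `]0, 1[) c.2 &
                           (curve D f @` `]0, 1[) c.2]].

Definition drawable_with (R : realType) (G : multigraph) (n : nat) : Prop :=
  exists D : drawing R G, (crossings D #= `I_n)%card.

(* The least n with [drawable_with R G n]; the default value 0 is never used,
   since every finite graph has a drawing with finitely many crossings. *)
Definition crossing_number (R : realType) (G : multigraph) : nat :=
  xget 0%N [set n | drawable_with R G n /\
                    forall m, drawable_with R G m -> (n <= m)%N].

Definition crossing_critical (R : realType) (k : nat) (G : multigraph) : Prop :=
  (k <= crossing_number R G)%N /\
  forall e : edge G, (crossing_number R (del_edge e) < k)%N.

(* Main.v *)
Require Import Defs.
From mathcomp Require Import all_boot all_order all_algebra all_fingroup.
From mathcomp Require Import all_classical all_reals all_analysis.
From mathcomp Require Import ring lra.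

(* To delete an edge of one factor, take optimal drawings of that factor without
   the edge and of the other factor; to delete a zipping edge, take optimal
   drawings of both factors without the edges it comes from.  Around the vertex [v] of a
   drawing there is a disc which meets nothing but the edges at [v]; cutting
   each of these where it first hits the circle and inverting the plane at a
   point of the circle puts the rest of the drawing into a half-plane, with the
   edges at [v] ending on the boundary line.  The opened drawings of the factors
   are put on the two sides of a line and joined, which adds no crossings, as
   soon as their boundary points come in corresponding orders.  That can be
   arranged: a homogeneous neighbourhood allows every permutation of the
   boundary points of one side, and three points can be put in every order by
   an inversion centred on the line and a reflection.  So deleting an edge of
   the zip product leaves a graph with fewer than [k] crossings. *)

Set Implicit Arguments.
Unset Strict Implicit.
Unset Printing Implicit Defensive.

Section CrossingsOfZipProducts.
Import Order.TTheory GRing.Theory Num.Theory.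
Import numFieldNormedType.Exports.
Local Open Scope classical_set_scope.
Local Open Scope ring_scope.

Section Arcs.
Variable R : realType.
Implicit Types (p q r x y : R * R) (A B : set (R * R)) (s t : R).

Definition arc p q A := exists c : R -> R * R,
  [/\ {within `[0, 1]%classic, continuous c}, {in `[0, 1] &, injective c},
      c 0 = p, c 1 = q & c @` `[0, 1]%classic = A].

Lemma within_comp (T U V : topologicalType) (f : T -> U) (g : U -> V)
    (A : set T) (B : set U) :
  f @` A `<=` B -> {within A, continuous f} -> {within B, continuous g} ->
  {within A, continuous (g \o f)}.
Proof.
move=> fAB /subspace_continuousP cf /subspace_continuousP cg.
apply/subspace_continuousP => t At W /= gW.
have Bft : B (f t) by apply: fAB; exists t.
have := cf _ At _ (cg _ Bft _ gW); rewrite /nbhs /= /within /=.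
by apply: filterS => t' + At'; apply => //; apply: fAB; exists t'.
Qed.

Lemma arc_reparam (a b : R) (c : R -> R * R) : a < b ->
  {within `[a, b]%classic, continuous c} -> {in `[a, b] &, injective c} ->
  arc (c a) (c b) (c @` `[a, b]%classic).
Proof.
move=> ab cc ic; pose f t := a + t * (b - a).
have fi t : (f t \in `[a, b]) = (t \in `[0, 1]).
  rewrite !in_itv /= /f; apply/andP/andP=> -[h1 h2]; split; nra.
have fim : f @` `[0, 1]%classic = `[a, b]%classic.
  apply/seteqP; split => [_ [t t01 <-]|x xab]; first by rewrite /= fi.
  exists ((x - a) / (b - a)).
    by rewrite /= -fi /f mulfVK ?subr_eq0 ?gt_eqF // addrC subrK.
  by rewrite /f mulfVK ?subr_eq0 ?gt_eqF // addrC subrK.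
exists (c \o f); split.
- apply: (@within_comp _ _ _ f c `[0, 1]%classic `[a, b]%classic) => //.
    by rewrite fim.
  apply: continuous_subspaceT => t; rewrite /f.
  apply: cvgD; first exact: cvg_cst.
  by apply: cvgM; [exact: cvg_id|exact: cvg_cst].
- move=> s t s01 t01 /ic; rewrite !fi => /(_ s01 t01) /addrI /mulIf.
  by apply; rewrite subr_eq0 gt_eqF.
- by rewrite /= /f mul0r addr0.
- by rewrite /= /f mul1r addrC subrK.
- by rewrite -fim image_comp.
Qed.

Lemma arc_sym p q A : arc p q A -> arc q p A.
Proof.
case=> c [cc ic <- <- <-]; exists (fun t => c (1 - t)).
have fi t : (1 - t \in `[0, 1]) = (t \in `[0, 1]).
  by rewrite !in_itv /=; apply/andP/andP => -[h1 h2]; split; lra.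
have fim : (fun t : R => 1 - t) @` `[0, 1]%classic = `[0, 1]%classic.
  apply/seteqP; split => [_ [t t01 <-]|x x01]; first by rewrite /= fi.
  by exists (1 - x); [rewrite /= fi|rewrite subKr].
split.
- apply: (@within_comp _ _ _ (fun t : R => 1 - t) c
            `[0, 1]%classic `[0, 1]%classic) => //.
    by rewrite fim.
  apply: continuous_subspaceT => t.
  by apply: cvgB; [exact: cvg_cst|exact: cvg_id].
- move=> s t s01 t01 /ic; rewrite !fi => /(_ s01 t01); lra.
- by rewrite subr0.
- by rewrite subrr.
- by rewrite -{2}fim image_comp.
Qed.

Lemma arc_ends p q A : arc p q A -> [/\ A p, A q & p != q].
Proof.
have i0 : 0 \in `[0, 1 : R] by rewrite in_itv /= lexx ler01.
have i1 : 1 \in `[0, 1 : R] by rewrite in_itv /= lexx ler01.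
case=> c [cc ic <- <- <-]; split; [by exists 0|by exists 1|].
by apply/eqP => /ic - /(_ i0 i1) /esym /eqP; rewrite oner_eq0.
Qed.

Lemma arc_image (phi : R * R -> R * R) p q A :
  (forall x, A x -> {for x, continuous phi}) ->
  {in A &, injective phi} -> arc p q A -> arc (phi p) (phi q) (phi @` A).
Proof.
move=> cphi iphi [c [cc ic <- <- cA]].
exists (phi \o c); split => //.
- apply: (@within_comp _ _ _ c phi `[0, 1]%classic A) => //.
    by rewrite cA.
  by apply: continuous_in_subspaceT => x; rewrite inE => /cphi.
- move=> s t s01 t01 /iphi e; apply: ic => //; apply: e; rewrite inE -cA.
    by exists s.
  by exists t.
- by rewrite -cA image_comp.
Qed.

Lemma arc_cat p q r A B : arc p q A -> arc q r B ->
  (forall x, A x -> B x -> x = q) -> arc p r (A `|` B).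
Proof.
have U : (`[0, 1] `|` `[1, 2] = `[0, 2 : R])%classic.
  apply/seteqP; split => t /=; rewrite !in_itv /=.
    by case=> /andP[h1 h2]; apply/andP; split; lra.
  move=> /andP[h1 h2]; have [h|/ltW h] := @leP _ R t 1; [left|right];
    by apply/andP; split; lra.
have n21 : ~~ (2 <= 1 :> R) by rewrite -ltNge; lra.
have e21 : 2 - 1 = 1 :> R by lra.
case=> c [cc ic <- <- <-] [d [cd id dc <- <-]] cap.
pose f t := if t <= 1 then c t else d (t - 1).
have f1 t : t \in `[0, 1] -> f t = c t by rewrite in_itv /f /= => /andP[_ ->].
have f2 t : t \in `[1, 2] -> f t = d (t - 1).
  rewrite in_itv /f /= => /andP[t1 _]; case: ifP => // t1'.
  by rewrite (@le_anti _ _ t 1) ?t1 ?t1' // subrr dc.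
have i12 t : t \in `[1, 2] = (t - 1 \in `[0, 1]).
  by rewrite !in_itv /=; apply/andP/andP => -[h1 h2]; split; lra.
have dim : (fun t : R => t - 1) @` `[1, 2]%classic = `[0, 1]%classic.
  apply/seteqP; split => [_ [t t01 <-]|x x01]; first by rewrite /= -i12.
  by exists (x + 1); rewrite /= ?i12 addrK.
have spl t : t \in `[0, 2] -> t \in `[0, 1] \/ t \in `[1, 2].
  by move=> h; have : (`[0, 2 : R])%classic t by []; rewrite -U.
have fe1 : f @` `[0, 1]%classic = c @` `[0, 1]%classic.
  by apply: eq_imagel => t /= ?; rewrite f1.
have fe2 : f @` `[1, 2]%classic = d @` `[0, 1]%classic.
  rewrite -dim image_comp.
  by apply: eq_imagel => t /= ?; rewrite f2.
have fe : c @` `[0, 1]%classic `|` d @` `[0, 1]%classic = f @` `[0, 2]%classic.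
  by rewrite -U image_setU fe1 fe2.
have f0 : f 0 = c 0 by rewrite /f ler01.
have f2e : f 2 = d 1.
  by rewrite /f (negbTE n21) e21.
rewrite fe -f0 -f2e; apply: arc_reparam; first lra.
- rewrite -U; apply: withinU_continuous; try exact: itv_closed.
    apply: (@subspace_eq_continuous _ _ _ c) cc => t.
    by rewrite inE => /f1.
  apply: (@subspace_eq_continuous _ _ _ (d \o (fun t => t - 1))).
    by move=> t; rewrite inE => /f2.
  apply: (within_comp _ _ cd); first by rewrite dim.
  apply: continuous_subspaceT => t.
  by apply: cvgB; [exact: cvg_id|exact: cvg_cst].
- have mixed s t : s \in `[0, 1] -> t \in `[1, 2] -> f s = f t -> s = t.
    move=> hs ht; rewrite (f1 _ hs) (f2 _ ht) => e.
    have e1 : c s = c 1.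
      by apply: cap; [exists s|rewrite e; exists (t - 1); rewrite /= -?i12].
    have i0 : 0 \in `[0, 1 : R] by rewrite in_itv /= lexx ler01.
    have i1 : 1 \in `[0, 1 : R] by rewrite in_itv /= lexx ler01.
    rewrite (ic _ _ hs i1 e1) in e *.
    have : t - 1 = 0 by apply: id => //; rewrite ?dc // -i12.
    by clear; lra.
  move=> s t /spl[hs|hs] /spl[ht|ht].
  + by rewrite !f1 //; apply: ic.
  + exact: mixed.
  + by move/esym/(mixed _ _ ht hs).
  + rewrite !f2 // => /id; rewrite -!i12 => /(_ hs ht); clear; lra.
Qed.

Lemma continuous_pair (T : topologicalType) (f g : T -> R) (t : T) :
  {for t, continuous f} -> {for t, continuous g} ->
  {for t, continuous (fun s : T => (f s, g s))}.
Proof. by move=> cf cg; exact: (cvg_pair cf cg). Qed.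

Lemma within_gt0 (A : set R) (h : R -> R) t : {within A, continuous h} ->
  A t -> 0 < h t ->
  exists2 e, 0 < e & forall s, A s -> `|s - t| < e -> 0 < h s.
Proof.
move=> /subspace_continuousP ch At /(cvgr_gt _ (ch _ At)).
rewrite /nbhs /= => /nbhs_ballP[e /= e0 he]; exists e => // s As st.
by apply: he => //; rewrite /ball /= distrC.
Qed.

Lemma arc_segment p q : p != q ->
  arc p q [set x | exists2 t : R, t \in `[0, 1] &
    x = (p.1 + t * (q.1 - p.1), p.2 + t * (q.2 - p.2))].
Proof.
move=> pq; exists (fun t => (p.1 + t * (q.1 - p.1), p.2 + t * (q.2 - p.2))).
split.
- apply: continuous_subspaceT => t.
  by apply: (@continuous_pair R (fun t => p.1 + t * (q.1 - p.1))
      (fun t => p.2 + t * (q.2 - p.2)));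
    (apply: cvgD; [exact: cvg_cst|apply: cvgM; [exact: cvg_id|exact: cvg_cst]]).
- move=> s t _ _ [] /addrI e1 /addrI e2.
  have [e|ne] := eqVneq q.1 p.1.
    have ne2 : q.2 - p.2 != 0.
      rewrite subr_eq0; apply: contraNneq pq => e'.
      by rewrite (surjective_pairing p) (surjective_pairing q) e e'.
    exact: (mulIf ne2).
  by apply: (mulIf _ e1); rewrite subr_eq0.
- by rewrite !mul0r !addr0 -surjective_pairing.
- by rewrite !mul1r !(addrC _ (_ - _)) !subrK -surjective_pairing.
- by apply/seteqP; split => x /= -[t ? ?]; exists t.
Qed.

Lemma arc_closed p q A : arc p q A -> closed A.
Proof.
case=> c [cc _ _ _ <-].
apply: compact_closed; first exact: norm_hausdorff.
by apply: continuous_compact => //; exact: segment_compact.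
Qed.

Lemma arc_first_hit (g : R * R -> R) p q A : continuous g ->
  0 < g p -> g q < 0 -> arc p q A ->
  exists x A', [/\ arc p x A', A' `<=` A, g x = 0 &
    forall y, A' y -> y = x \/ 0 < g y].
Proof.
move=> cg gp gq [c [cc ic c0 c1 cA]].
pose h := g \o c.
have ch : {within `[0, 1]%classic, continuous h}.
  apply: (within_comp _ cc (B := setT)) => //.
  exact: continuous_subspaceT.
pose Z := [set t : R | t \in `[0, 1] /\ h t <= 0].
have Z1 : Z 1 by split; rewrite ?in_itv /= ?lexx ?ler01 // /h /= c1 ltW.
have Zinf : has_inf Z.
  by split; [exists 1|exists 0 => t [] /[!in_itv] /andP[]].
pose T := inf Z.
have T0 : 0 <= T by apply: lb_le_inf; [exists 1|move=> t [] /[!in_itv] /andP[]].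
have T1 : T <= 1 by apply: ge_inf => //; case: Zinf.
have T01 : T \in `[0, 1] by rewrite in_itv /= T0 T1.
have ltT t : 0 <= t -> t < T -> 0 < h t.
  move=> t0 tT; rewrite ltNge; apply/negP => ht.
  suff : T <= t by rewrite leNgt tT.
  apply: ge_inf; first by case: Zinf.
  by split=> //; rewrite in_itv /= t0; lra.
have hT0 : h T <= 0.
  rewrite leNgt; apply/negP => /(within_gt0 ch T01)[e e0 he].
  have [z [z01 hz] zT] := inf_adherent e0 Zinf.
  have Tz : T <= z by apply: ge_inf; [case: Zinf|].
  have : 0 < h z by apply: he => //; rewrite ger0_norm; lra.
  by rewrite ltNge hz.
have Tgt : 0 < T.
  rewrite lt_neqAle T0 andbT; apply: contraTneq hT0 => <-.
  by rewrite -ltNge /h /= c0.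
have hT : h T = 0.
  apply/le_anti; rewrite hT0 /= leNgt; apply/negP => hT.
  have cN : {within `[0, 1]%classic, continuous (-%R \o h)}.
    apply: (within_comp _ ch (B := setT)) => //.
    by apply: continuous_subspaceT => t; exact: cvgN.
  have [|e e0 he] := within_gt0 cN T01; first by rewrite /= oppr_gt0.
  pose t := Num.max 0 (T - e / 2).
  have t0 : 0 <= t by rewrite le_max lexx.
  have tT : t < T by rewrite gt_max Tgt; lra.
  have te : T - e / 2 <= t by rewrite le_max lexx orbT.
  have : 0 < (-%R \o h) t.
    by apply: he; rewrite /= ?in_itv /= ?t0 /=; [lra|rewrite ltr0_norm; lra].
  by rewrite /= oppr_gt0 ltNge ltW // ltT.
have sub : `[0, T] `<=` `[0, 1 : R]%classic.
  by move=> t /=; rewrite !in_itv /= => /andP[-> tT]; exact: le_trans T1.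
exists (c T), (c @` `[0, T]%classic); split => //.
- rewrite -c0; apply: arc_reparam => //.
    exact: continuous_subspaceW cc.
  by move=> s t /sub hs /sub ht; apply: ic.
- by rewrite -cA; apply: image_subset.
- move=> _ [t /= + <-]; rewrite in_itv /= => /andP[t0].
  by rewrite le_eqVlt => /orP[/eqP -> |tT]; [left|right; exact: ltT].
Qed.
End Arcs.

Section OpenedDrawings.
Variable R : realType.
Local Notation plane := (R * R)%type.

Definition at_most (T : eqType) (X : set T) (n : nat) :=
  exists2 s : seq T, (size s <= n)%N & forall x, X x -> x \in s.

Lemma at_most_image (T T' : eqType) (h : T -> T') (X : set T) (Y : set T') n :
  Y `<=` h @` X -> at_most X n -> at_most Y n.
Proof.
move=> YX [s sn Xs]; exists (map h s); first by rewrite size_map.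
by move=> _ /YX[x /Xs xs <-]; exact: map_f.
Qed.

Lemma at_most_setU (T : eqType) (X Y : set T) m n :
  at_most X m -> at_most Y n -> at_most (X `|` Y) (m + n).
Proof.
move=> [s sm Xs] [t tn Yt]; exists (s ++ t); first by rewrite size_cat leq_add.
by move=> x [/Xs|/Yt]; rewrite mem_cat => ->; rewrite ?orbT.
Qed.

Definition common_points (E : finType) (S : {set E}) (A : E -> set plane)
    (P : set plane) : set ({set E} * plane) :=
  [set c | exists e f, [/\ e \in S, f \in S & e != f] /\
    [/\ c.1 = [set e; f]%SET, A e c.2, A f c.2 & ~ P c.2]].

Definition nbrs (G : multigraph) (S : {set edge G}) (v : vertex G) :=
  [set u | [exists e in S, ends e == [set u; v]%SET]]%SET.

Lemma nbrsP (G : multigraph) (S : {set edge G}) (v u : vertex G) :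
  reflect (exists2 e, e \in S & ends e = [set u; v]%SET) (u \in nbrs S v).
Proof.
rewrite inE; apply: (iffP existsP) => [[e /andP[eS /eqP ue]]|[e eS ue]].
  by exists e.
by exists e; rewrite eS ue eqxx.
Qed.

Lemma ends_other (G : multigraph) (e : edge G) v : v \in ends e ->
  exists2 u, u != v & ends e = [set u; v]%SET.
Proof.
have /eqP/cards2P[x [y [xy exy]]] := card_ends e.
rewrite exy !inE => /orP[] /eqP ->; last by exists x.
by exists y; rewrite 1?eq_sym // finset.setUC.
Qed.

Lemma set2_inl (T : finType) (u w v : T) : [set u; v]%SET = [set w; v]%SET ->
  u != v -> u = w.
Proof.
move=> /setP /(_ u); rewrite !inE eqxx /= => /esym/orP[/eqP //|/eqP ->].
by rewrite eqxx.
Qed.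

Lemma arc_ends_set2 (G : multigraph) (e : edge G) (pos : vertex G -> plane) A
    u w :
  ends e = [set u; w]%SET ->
  (exists u' w', ends e = [set u'; w']%SET /\ arc (pos u') (pos w') A) ->
  arc (pos u) (pos w) A.
Proof.
move=> euw [u' [w' [euw' a]]].
have uw' : u' != w'.
  by have := card_ends e; rewrite euw' cards2; case: (u' != w').
have : u' \in ends e by rewrite euw' !inE eqxx.
have : w' \in ends e by rewrite euw' !inE eqxx orbT.
rewrite euw !inE => /orP[/eqP w'u|/eqP w'w] /orP[/eqP u'u|/eqP u'w].
- by rewrite w'u u'u eqxx in uw'.
- by rewrite -w'u -u'w; exact: arc_sym.
- by rewrite -w'w -u'u.
- by rewrite w'w u'w eqxx in uw'.
Qed.

(* The edges of [S] form the drawn spanning subgraph of [G]; the edge [e] is the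
   point set [A e]. *)
Variant drawn (G : multigraph) (S : {set edge G}) (n : nat) : Prop :=
  Drawn (pos : vertex G -> plane) (A : edge G -> set plane) of
    injective pos &
    (forall e, e \in S -> exists u w,
       ends e = [set u; w]%SET /\ arc (pos u) (pos w) (A e)) &
    (forall e w, e \in S -> A e (pos w) -> w \in ends e) &
    at_most (common_points S A (range pos)) n.

(* [v] is removed and the edges at [v] are cut off: the edge from [u] to [v]
   ends at the point [b u] of the boundary of the region where [g] is positive,
   which contains everything else. *)
Variant opened (G : multigraph) (v : vertex G) (S : {set edge G})
    (g : plane -> R) (b : vertex G -> plane) (n : nat) : Prop :=
  Opened (pos : vertex G -> plane) (A : edge G -> set plane) of
    (forall u w, u != v -> w != v -> pos u = pos w -> u = w) &
    (forall u, u != v -> 0 < g (pos u)) &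
    (forall e, e \in S -> v \notin ends e ->
       (exists u w, ends e = [set u; w]%SET /\ arc (pos u) (pos w) (A e)) /\
       forall x, A e x -> 0 < g x) &
    (forall e u, e \in S -> ends e = [set u; v]%SET ->
       [/\ arc (pos u) (b u) (A e), g (b u) = 0 &
           forall x, A e x -> x = b u \/ 0 < g x]) &
    (forall e w, e \in S -> w != v -> A e (pos w) -> w \in ends e) &
    {in nbrs S v &, injective b} &
    at_most (common_points S A (pos @` [set u | u != v])) n.

Lemma opened_ext (G : multigraph) (v : vertex G) (S : {set edge G}) g b b' n :
  {in nbrs S v, b =1 b'} -> opened v S g b n -> opened v S g b' n.
Proof.
move=> bb' [pos A ipos gpos far near av ib cr]; exists pos A => //.
  move=> e u eS eu; rewrite -bb'; first exact: near.
  by apply/nbrsP; exists e.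
by move=> u w hu hw; rewrite -!bb' //; exact: ib.
Qed.

Lemma opened_map (phi : plane -> plane) (D : set plane) (g' : plane -> R)
    (G : multigraph) (v : vertex G) (S : {set edge G}) g b n :
  (forall x, 0 < g x -> D x) -> (forall u, u \in nbrs S v -> D (b u)) ->
  (forall x, D x -> {for x, continuous phi}) -> {in D &, injective phi} ->
  (forall x, 0 < g x -> 0 < g' (phi x)) ->
  (forall u, u \in nbrs S v -> g' (phi (b u)) = 0) ->
  opened v S g b n -> opened v S g' (phi \o b) n.
Proof.
move=> gD bD cphi iphi gg' bg' [pos A ipos gpos far near av ib cr].
have inj x y : D x -> D y -> phi x = phi y -> x = y.
  by move=> Dx Dy; apply: iphi; rewrite inE.
have AD e x : e \in S -> A e x -> D x.
  move=> eS Aex; have [ve|ve] := boolP (v \in ends e).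
    have [u uv eu] := ends_other ve.
    have [_ _ /(_ _ Aex)[->|/gD //]] := near _ _ eS eu.
    by apply: bD; apply/nbrsP; exists e.
  by have [_ /(_ _ Aex)/gD] := far _ eS ve.
have Aarc e p q : e \in S -> arc p q (A e) ->
    arc (phi p) (phi q) (phi @` A e).
  move=> eS; apply: arc_image; first by move=> x /(AD _ _ eS)/cphi.
  by move=> x y; rewrite !inE => /(AD _ _ eS) Dx /(AD _ _ eS) Dy; exact: inj.
have posD u : u != v -> D (pos u) by move=> uv; exact/gD/gpos.
exists (phi \o pos) (fun e => phi @` A e).
- by move=> u w uv wv /(inj _ _ (posD _ uv) (posD _ wv)); exact: ipos.
- by move=> u uv; apply/gg'/gpos.
- move=> e eS ve; have [[u [w [euw a]]] pos_e] := far _ eS ve; split.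
    by exists u, w; split; last exact: Aarc.
  by move=> _ [x /pos_e gx <-]; exact: gg'.
- move=> e u eS eu; have [a gb Ag] := near _ _ eS eu.
  have unb : u \in nbrs S v by apply/nbrsP; exists e.
  split; [exact: Aarc|exact: bg'|].
  by move=> _ [x /Ag[->|gx] <-]; [left|right; exact: gg'].
- move=> e w eS wv [x Ax /(inj _ _ (AD _ _ eS Ax) (posD _ wv)) xw].
  by apply: av => //; rewrite -xw.
- move=> u w hu hw /(inj _ _ (bD _ hu) (bD _ hw)); exact: ib.
- apply: (at_most_image (h := fun c : {set edge G} * plane => (c.1, phi c.2))) cr => -[E y] /=.
  move=> [e [f [[eS fS ef] [/= -> [x Aex xy] [x' Afx' x'y] nP]]]].
  have xx' : x = x'.
    by apply: inj; [exact: AD eS _|exact: AD fS _|rewrite xy].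
  exists ([set e; f]%SET, x); rewrite /= ?xy //; exists e, f.
  split; split=> //=; first by rewrite xx'.
  by move=> [u uv ux]; apply: nP; exists u => //=; rewrite ux.
Qed.

End OpenedDrawings.

Section OpeningAVertex.
Variable R : realType.
Local Notation plane := (R * R)%type.
Implicit Types (p q x y z : plane) (A C : set plane).

Definition sqdist p x : R := (x.1 - p.1) ^+ 2 + (x.2 - p.2) ^+ 2.

Lemma sqdist_ge0 p x : 0 <= sqdist p x.
Proof. by rewrite addr_ge0 ?sqr_ge0. Qed.

Lemma sqdist_eq0 p x : (sqdist p x == 0) = (x == p).
Proof.
rewrite /sqdist paddr_eq0 ?sqr_ge0 // !sqrf_eq0 !subr_eq0.
by case: x p => ? ? [].
Qed.

Lemma continuous_sqdist p : continuous (sqdist p).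
Proof.
move=> x; have c1 : {for x, continuous (fun y : plane => y.1 - p.1)}.
  by apply: cvgB; [exact: cvg_fst|exact: cvg_cst].
have c2 : {for x, continuous (fun y : plane => y.2 - p.2)}.
  by apply: cvgB; [exact: cvg_snd|exact: cvg_cst].
have c (f : plane -> R) : {for x, continuous f} ->
    {for x, continuous (fun y => f y ^+ 2)}.
  by move=> cf; apply: cvgM.
by apply: cvgD; exact: c.
Qed.

Lemma closed_away p C : closed C -> ~ C p ->
  exists2 r, 0 < r & forall x, C x -> r < sqdist p x.
Proof.
move=> cC Cp; have : nbhs p (~` C).
  by apply: open_nbhs_nbhs; split => //; exact: closed_openC.
move=> /nbhs_ballP[e /= e0 eC]; exists (e ^+ 2 / 2).
  by rewrite divr_gt0 ?exprn_gt0.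
move=> x Cx; rewrite ltNge; apply/negP => xe.
have e2 : e ^+ 2 / 2 < e ^+ 2 by have := exprn_gt0 2 e0; lra.
have near (a : R) : a ^+ 2 <= e ^+ 2 / 2 -> `|a| < e.
  move=> ae; rewrite -(@ltr_pXn2r _ 2) ?nnegrE ?normr_ge0 ?(ltW e0) //.
  by rewrite real_normK ?num_real //; exact: le_lt_trans e2.
apply: (eC x) => //; split => /=; rewrite /ball /= distrC; apply: near;
  apply: le_trans xe; rewrite /sqdist.
  by rewrite lerDl sqr_ge0.
by rewrite lerDr sqr_ge0.
Qed.

Lemma fresh_real (s : seq R) : exists x : R, x \notin s.
Proof.
exists (1 + \sum_(y <- s) `|y|); apply/negP => xs.
have : 1 + \sum_(y <- s) `|y| <= \sum_(y <- s) `|y|.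
  rewrite (le_trans (ler_norm _)) // [leRHS](big_rem _ xs) /= lerDl.
  by apply: sumr_ge0.
by lra.
Qed.

Lemma fresh_circle_point p (r : R) (s : seq plane) : 0 < r ->
  exists2 z, sqdist p z = r & z \notin s.
Proof.
move=> r0; pose rho := Num.sqrt r.
have rho2 : rho ^+ 2 = r by rewrite sqr_sqrtr // ltW.
have rho0 : 0 < rho by rewrite sqrtr_gt0.
have [k ks] := fresh_real [seq (x.2 - p.2) / (rho + (x.1 - p.1)) | x <- s].
have k2 : 0 < 1 + k ^+ 2 by rewrite ltr_pwDl ?ltr01 ?sqr_ge0.
exists (p.1 + rho * ((1 - k ^+ 2) / (1 + k ^+ 2)),
        p.2 + rho * (2 * k / (1 + k ^+ 2))).
  rewrite /sqdist /= -rho2; field; lra.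
apply: contra ks => zs; apply/mapP; eexists; first exact: zs.
rewrite /=; field; rewrite gt_eqF //=; nra.
Qed.

(* The disc is chosen so small that two edges meet in it only at [pos v],
   so different edges at [v] hit the circle in different points. *)
Lemma opened_disc (G : multigraph) (v : vertex G) S n :
  simple_vertex v -> drawn R S n ->
  exists p (r : R) b, 0 < r /\ opened v S (fun x => sqdist p x - r) b n.
Proof.
move=> v_simple [pos A ipos Aarc av [s sn sP]].
pose p := pos v.
have ends_v e f u : ends e = [set u; v]%SET -> ends f = [set u; v]%SET -> e = f.
  by move=> eu fu; apply: v_simple; rewrite ?eu ?fu ?finset.inE ?eqxx ?orbT.
pose C1 := \bigcup_(e in [set e | e \in S /\ v \notin ends e]) A e.
pose C2 := pos @` [set u | u != v].
pose C3 := [set x | exists2 c, c \in s & x = c.2 /\ x != p].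
have fin (T : finType) (X : set T) : finite_set X.
  by apply: (sub_finite_set (B := setT)) => //; exact: finite_finset.
have finC (X : set plane) : finite_set X -> closed X.
  apply: (iffLR accessible_finite_set_closed).
  by apply/hausdorff_accessible/norm_hausdorff.
have cl : closed (C1 `|` (C2 `|` C3)).
  apply: closedU; last apply: closedU.
  - apply: closed_bigcup => [|e [eS _]]; first exact: fin.
    by have [u [w [_ /arc_closed]]] := Aarc _ eS.
  - by apply: finC; apply: finite_image; exact: fin.
  - apply: finC; apply: (sub_finite_set (B := [set` map snd s])).
      by move=> _ [c cs [-> _]] /=; apply: map_f.
    exact: finite_seq.
have Cp : ~ (C1 `|` (C2 `|` C3)) p.
  case=> [[e [eS ve] /(av _ _ eS)]|[[u /eqP uv /ipos //]|[c _ [_ /eqP //]]]].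
  by rewrite (negbTE ve).
have [r r0 rC] := closed_away cl Cp.
pose g x := sqdist p x - r.
have cg : continuous g.
  by move=> x; apply: cvgB; [exact: continuous_sqdist|exact: cvg_cst].
have gp : g p < 0 by rewrite subr_lt0 (eqP (_ : sqdist p p == 0)) ?sqdist_eq0.
have hit e : exists xB : plane * set plane, e \in S -> v \in ends e ->
    exists u, [/\ u != v, ends e = [set u; v]%SET, arc (pos u) xB.1 xB.2,
      xB.2 `<=` A e & g xB.1 = 0 /\ forall y, xB.2 y -> y = xB.1 \/ 0 < g y].
  have [eS|] := boolP (e \in S); last by exists (p, set0).
  have [ve|] := boolP (v \in ends e); last by exists (p, set0).
  have [u uv eu] := ends_other ve.
  have gu : 0 < g (pos u) by rewrite subr_gt0; apply: rC; right; left; exists u.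
  have a : arc (pos u) (pos v) (A e).
    by apply: arc_ends_set2 eu _; exact: Aarc.
  have [x [B [aB BA gx Bg]]] := arc_first_hit cg gu gp a.
  by exists (x, B) => _ _; exists u.
have [h hP] := choice hit.
have hE e u : e \in S -> ends e = [set u; v]%SET ->
    [/\ arc (pos u) (h e).1 (h e).2, (h e).2 `<=` A e, g (h e).1 = 0 &
        forall y, (h e).2 y -> y = (h e).1 \/ 0 < g y].
  move=> eS eu; have ve : v \in ends e by rewrite eu !finset.inE eqxx orbT.
  have [u' [u'v eu' a sub [g0 gpos]]] := hP _ eS ve.
  by have <- : u' = u by apply: set2_inl u'v; rewrite -eu' eu.
pose b u := if [pick e in S | ends e == [set u; v]%SET] is Some e
            then (h e).1 else p.
have bE e u : e \in S -> ends e = [set u; v]%SET -> b u = (h e).1.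
  move=> eS eu; rewrite /b; case: pickP => [f /andP[_ /eqP fu]|/(_ e)].
    by rewrite (ends_v _ _ _ eu fu).
  by rewrite eS eu eqxx.
pose B e := if v \in ends e then (h e).2 else A e.
have BA e : e \in S -> B e `<=` A e.
  move=> eS; rewrite /B; case: ifP => [ve|_]; last by move=> x.
  by have [u uv eu] := ends_other ve; have [] := hE _ _ eS eu.
exists p, r, b; split => //; exists pos B.
- by move=> u w _ _ /ipos.
- by move=> u uv; rewrite subr_gt0; apply: rC; right; left; exists u.
- move=> e eS ve; rewrite /B (negbTE ve); split; first exact: Aarc.
  by move=> x Ax; rewrite subr_gt0; apply: rC; left; exists e.
- move=> e u eS eu; rewrite /B (bE _ _ eS eu).
  have -> : v \in ends e by rewrite eu !finset.inE eqxx orbT.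
  by have [? _ ? ?] := hE _ _ eS eu.
- by move=> e w eS _ /(BA _ eS); exact: av.
- move=> u w /nbrsP[e eS eu] /nbrsP[f fS fw].
  rewrite (bE _ _ eS eu) (bE _ _ fS fw) => ef.
  have [ae eA ge _] := hE _ _ eS eu.
  have [af fA gf _] := hE _ _ fS fw.
  have Aex : A e (h e).1 by apply: eA; have [] := arc_ends ae.
  have Afx : A f (h e).1 by rewrite ef; apply: fA; have [] := arc_ends af.
  have uv : u != v by have := card_ends e; rewrite eu cards2; case: eqP.
  have [e_f|nef] := eqVneq e f.
    by apply: set2_inl uv; rewrite -eu -fw e_f.
  exfalso; have C : (C2 `|` C3) (h e).1.
    have [[w' _ pw']|nP] := pselect (range pos (h e).1).
      left; exists w' => //=; apply/eqP => w'v.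
      by move: gp; rewrite /p -w'v pw' ge ltxx.
    right; exists ([set e; f]%SET, (h e).1); last first.
      by split=> //=; apply: contra_notN nP => /eqP ->; exists v.
    by apply: sP; exists e, f.
  have := rC _ (or_intror C); rewrite -subr_gt0 -/(g _) ge ltxx; exact: notF.
- have sub : common_points S B (pos @` [set u | u != v]) `<=`
      common_points S A (range pos).
    move=> [E x] [e [f [[eS fS ef] [/= -> Bex Bfx nP]]]].
    exists e, f; split => //; split => //=; try exact: BA.
    move=> [w _ wx]; apply: nP; exists w => //=.
    apply/eqP => wv; rewrite {}wv in wx.
    have [ve|ve] := boolP (v \in ends e); last first.
      by move/negP: ve; apply; apply: (av _ _ eS); rewrite wx; exact: BA.
    have [u uv eu] := ends_other ve; have [_ _ h0 hpos] := hE _ _ eS eu.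
    move: Bex; rewrite /B ve -wx => /hpos[|]; last by rewrite ltNge ltW.
    by move=> ph; move: gp; rewrite /p ph h0 ltxx.
  by exists s => // c /sub /sP.
Qed.

Definition inversion z x : plane :=
  ((x.1 - z.1) / sqdist z x, (x.2 - z.2) / sqdist z x).

Lemma continuous_inversion z x : x != z -> {for x, continuous (inversion z)}.
Proof.
rewrite -sqdist_eq0 => xz; apply: continuous_pair; (apply: cvgM;
  [|by apply: cvgV => //; exact: continuous_sqdist]); apply: cvgB;
  by [exact: cvg_cst|exact: cvg_fst|exact: cvg_snd].
Qed.

Lemma inversion_inj z x y : x != z -> y != z ->
  inversion z x = inversion z y -> x = y.
Proof.
rewrite -!sqdist_eq0 => xz yz [e1 e2].
have inv x' : sqdist z x' != 0 -> (sqdist z x')^-1 =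
    ((x'.1 - z.1) / sqdist z x') ^+ 2 + ((x'.2 - z.2) / sqdist z x') ^+ 2.
  move=> nz; rewrite !expr_div_n -mulrDl -/(sqdist z x') expr2 invfM mulrA.
  by rewrite divff ?mul1r.
have s : sqdist z x = sqdist z y.
  by apply: invr_inj; rewrite (inv x xz) (inv y yz) e1 e2.
move: e1 e2; rewrite s => /mulIf - /(_ (invr_neq0 yz)) /addIr h1.
move=> /mulIf - /(_ (invr_neq0 yz)) /addIr h2.
by rewrite (surjective_pairing x) (surjective_pairing y) h1 h2.
Qed.

(* The inversion centred at a point [z] of the circle maps the circle to a line
   and the outside of the disc to a half-plane, which [lin] makes the upper
   one. *)
Lemma opened_halfplane (G : multigraph) (v : vertex G) S n :
  simple_vertex v -> drawn R S n ->
  exists a : vertex G -> R, opened v S snd (fun u => (a u, 0)) n.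
Proof.
move=> v_simple /(opened_disc v_simple)[p [r [b [r0 O]]]].
have [z zr zb] := fresh_circle_point p [seq b u | u <- enum (vertex G)] r0.
pose w1 := z.1 - p.1; pose w2 := z.2 - p.2.
have w_r : w1 ^+ 2 + w2 ^+ 2 = r by rewrite -zr.
pose lin y : plane := (w1 * y.2 - w2 * y.1, 1 + 2 * (w1 * y.1 + w2 * y.2)).
have clin : continuous lin.
  move=> x; apply: (@continuous_pair R plane (fun y => w1 * y.2 - w2 * y.1)
    (fun y => 1 + 2 * (w1 * y.1 + w2 * y.2))).
    by apply: cvgB; (apply: cvgM; [exact: cvg_cst|]);
      [exact: cvg_snd|exact: cvg_fst].
  apply: cvgD; first exact: cvg_cst.
  apply: cvgM; first exact: cvg_cst.
  by apply: cvgD; (apply: cvgM; [exact: cvg_cst|]);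
    [exact: cvg_fst|exact: cvg_snd].
have ilin : injective lin.
  move=> x y [f1 f2]; have rn : r != 0 by rewrite gt_eqF.
  rewrite (surjective_pairing x) (surjective_pairing y).
  have {}f2 : w1 * x.1 + w2 * x.2 = w1 * y.1 + w2 * y.2 by lra.
  have r1 (t : plane) : r * t.1 =
      w1 * (w1 * t.1 + w2 * t.2) - w2 * (w1 * t.2 - w2 * t.1).
    by rewrite -w_r; ring.
  have r2 (t : plane) : r * t.2 =
      w2 * (w1 * t.1 + w2 * t.2) + w1 * (w1 * t.2 - w2 * t.1).
    by rewrite -w_r; ring.
  by congr (_, _); apply: (mulfI rn); rewrite ?r1 ?r2 f1 f2.
pose D : set plane := [set x | x != z].
have lin2 x : D x -> (lin (inversion z x)).2 = (sqdist p x - r) / sqdist z x.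
  rewrite /D /= -sqdist_eq0 => xz.
  have -> : sqdist p x - r =
      sqdist z x + 2 * (w1 * (x.1 - z.1) + w2 * (x.2 - z.2)).
    by rewrite -w_r /sqdist /w1 /w2; ring.
  by rewrite /lin /= (mulrDl (sqdist z x)) divff // !mulrA -mulrDl -!mulrA.
pose phi := lin \o inversion z.
have cphi x : D x -> {for x, continuous phi}.
  move=> Dx; apply: continuous_comp; last exact: clin.
  exact: continuous_inversion.
have iphi : {in D &, injective phi}.
  by move=> x y; rewrite !inE => Dx Dy /ilin; exact: inversion_inj.
exists (fun u => (phi (b u)).1).
have bD u : u \in nbrs S v -> D (b u).
  by move=> _; apply: contraNneq zb => <-; apply: map_f; rewrite mem_enum.
have bg u : u \in nbrs S v -> (phi (b u)).2 = 0.
  move=> unb; rewrite lin2; last exact: bD.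
  case: O unb => pos A _ _ _ near _ _ _ /nbrsP[e eS eu].
  by have [_ -> _] := near _ _ eS eu; rewrite mul0r.
have gD x : 0 < sqdist p x - r -> D x.
  by move=> gx; apply: contraTneq gx => ->; rewrite zr subrr ltxx.
apply: opened_ext (opened_map gD bD cphi iphi _ bg O) => [u unb|x gx].
  by rewrite -(bg _ unb) -surjective_pairing.
rewrite lin2; last exact: gD.
by rewrite divr_gt0 // lt_neqAle sqdist_ge0 eq_sym sqdist_eq0 andbT; exact: gD.
Qed.
End OpeningAVertex.

Section BoundaryOrder.
Variable R : realType.
Local Notation plane := (R * R)%type.
Variables (G : multigraph) (v : vertex G) (S : {set edge G}) (n : nat).
Implicit Types (a b : vertex G -> R) (c : R).

Definition opened_at a := opened v S snd (fun u => (a u, 0)) n.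

Lemma opened_at_inj a : opened_at a -> {in nbrs S v &, injective a}.
Proof. by case=> pos A _ _ _ _ _ ia _ u w hu hw e; apply: ia; rewrite ?e. Qed.

(* Segments in a strip below the drawing move the boundary points. *)
Lemma opened_at_order a b : simple_vertex v ->
  {in nbrs S v &, forall u w, a u < a w -> b u < b w} ->
  opened_at a -> opened_at b.
Proof.
have gt1 (t : R) : 0 < t -> 1 <= t + 1 /\ t + 1 <> 1 by move=> ?; split; lra.
move=> v_simple ab O; have ia := opened_at_inj O.
case: O => pos A ipos gpos far near av _ cr.
pose phi (x : plane) : plane := (x.1, x.2 + 1).
have cphi x : {for x, continuous phi}.
  apply: continuous_pair; first exact: cvg_fst.
  by apply: cvgD; [exact: cvg_snd|exact: cvg_cst].
have iphi : injective phi.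
  move=> x y [e1 /addIr e2].
  by rewrite (surjective_pairing x) (surjective_pairing y) e1 e2.
pose seg u : set plane := [set x | exists2 t : R, t \in `[0, 1] &
  x = (a u + t * (b u - a u), 1 + t * (0 - 1))].
have aseg u : arc (a u, 1) (b u, 0) (seg u).
  apply: (@arc_segment _ (a u, 1) (b u, 0)); rewrite xpair_eqE.
  by rewrite oner_eq0 andbF.
have segP u x : seg u x -> 0 <= x.2 <= 1.
  move=> [t + ->] /=; rewrite in_itv /= => /andP[t0 t1].
  by apply/andP; split; lra.
have seg0 u x : seg u x -> x.2 = 0 -> x = (b u, 0).
  move=> [t _ ->] /= t1; have -> : t = 1 by lra.
  by congr (_, _); ring.
have seg1 u x : seg u x -> x.2 = 1 -> x = (a u, 1).
  move=> [t _ ->] /= t1; have -> : t = 0 by lra.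
  by congr (_, _); ring.
have seg_disj u w x : a u < a w -> b u < b w -> seg u x -> ~ seg w x.
  move=> auw buw [t + ->] [t' _ []]; rewrite in_itv /= => /andP[t0 t1] e1 e2.
  have tt' : t' = t by lra.
  rewrite {}tt' in e1; have [t1'|t1'] := ltP t 1.
    have h1 : 0 < (1 - t) * (a w - a u) by rewrite mulr_gt0 ?subr_gt0.
    have h2 : 0 <= t * (b w - b u) by rewrite mulr_ge0 // subr_ge0 ltW.
    by nra.
  have t_1 : t = 1 by lra.
  by rewrite t_1 in e1; lra.
have phiA e x : e \in S -> (phi @` A e) x -> 1 <= x.2 /\
    (x.2 = 1 -> exists2 u, ends e = [set u; v]%SET & x = (a u, 1)).
  move=> eS [y Aey <-] /=; have [ve|ve] := boolP (v \in ends e); last first.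
    by have [_ /(_ _ Aey)/gt1[? ne1]] := far _ eS ve; split => // /ne1.
  have [u uv eu] := ends_other ve.
  have [_ _ /(_ _ Aey)[->|/gt1[? ne1]]] := near _ _ eS eu; last first.
    by split => // /ne1.
  by rewrite /phi /= add0r; split => // _; exists u.
pose B e := phi @` A e `|`
  [set x | exists2 u, ends e = [set u; v]%SET & seg u x].
have neq e u : ends e = [set u; v]%SET -> u != v.
  by move=> eu; have := card_ends e; rewrite eu cards2; case: eqP.
have other e u w : ends e = [set u; v]%SET -> ends e = [set w; v]%SET -> u = w.
  by move=> eu ew; apply: set2_inl (neq _ _ eu); rewrite -eu.
have arc_phi p q e : arc p q (A e) -> arc (phi p) (phi q) (phi @` A e).
  by apply: arc_image => // x y _ _; exact: iphi.
exists (phi \o pos) B.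
- by move=> u w uv wv /iphi; exact: ipos.
- by move=> u /gpos /= gu; lra.
- move=> e eS ve; have -> : B e = phi @` A e.
    rewrite /B -[RHS]setU0; congr (_ `|` _); rewrite -subset0 => x [u eu _].
    by rewrite eu !finset.inE eqxx orbT in ve.
  have [[u [w [euw aA]]] _] := far _ eS ve; split.
    by exists u, w; split; last exact: arc_phi.
  by move=> x /(phiA _ _ eS)[x1 _]; exact: lt_le_trans x1.
- move=> e u eS eu; have -> : B e = phi @` A e `|` seg u.
    rewrite /B; congr (_ `|` _); apply/seteqP; split=> [x [w ew]|x sx].
      by rewrite (other _ _ _ ew eu).
    by exists u.
  have [aA _ _] := near _ _ eS eu; split => //.
    apply: (@arc_cat _ _ (a u, 1)) (aseg u) _.
      have -> : (a u, 1) = phi (a u, 0) by rewrite /phi /= add0r.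
      exact: arc_phi.
    move=> x /(phiA _ _ eS)[x1 _] sx; apply: seg1 => //.
    by have /andP[_ x1'] := segP _ _ sx; apply/le_anti/andP.
  move=> x [/(phiA _ _ eS)[x1 _]|sx]; first by right; exact: lt_le_trans x1.
  have /andP[+ _] := segP _ _ sx.
  rewrite le_eqVlt => /orP[/eqP x0|]; last by right.
  by left; apply: seg0.
- move=> e w eS wv [[x Ax /iphi xw]|[u _ /segP/andP[_]]].
    by apply: av => //; rewrite -xw.
  by have := gpos _ wv; rewrite /= => gw1 gw2; exfalso; lra.
- move=> u w hu hw [bb]; apply: ia => //; apply/eqP; rewrite eq_le !leNgt.
  by apply/andP; split; apply/negP; [move/(ab _ _ hw hu)|move/(ab _ _ hu hw)];
    rewrite bb ltxx.
- apply: (at_most_image (h := fun c : {set edge G} * plane => (c.1, phi c.2))) cr.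
  move=> [E y] /=.
  move=> [e [f [[eS fS ef] [/= -> Be Bf nP]]]].
  have ends_v e' f' u : ends e' = [set u; v]%SET -> ends f' = [set u; v]%SET ->
      e' = f'.
    by move=> eu fu; apply: v_simple; rewrite ?eu ?fu // !finset.inE eqxx orbT.
  have mixed e' f' : e' \in S -> f' \in S -> e' != f' -> (phi @` A e') y ->
      ~ exists2 u, ends f' = [set u; v]%SET & seg u y.
    move=> e'S f'S e'f' pe [w fw sw]; have [y1 yE] := phiA _ _ e'S pe.
    have y2 : y.2 = 1 by have /andP[_ ?] := segP _ _ sw; apply/le_anti/andP.
    have [u eu yu] := yE y2; have := seg1 _ _ sw y2; rewrite yu => -[auw].
    have uw : u = w.
      by apply: ia => //; apply/nbrsP; [exists e'|exists f'].
    by move/eqP: e'f'; apply; apply: ends_v eu _; rewrite fw uw.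
  case: Be Bf => [pe|[u eu su]] [pf|[w fw sw]].
  + case: pe pf => [x Aex xy] [x' Afx' x'y].
    have xx' : x = x' by apply: iphi; rewrite xy.
    exists ([set e; f]%SET, x); rewrite /= ?xy //; exists e, f.
    split; split=> //=; first by rewrite xx'.
    by move=> [z zv zx]; apply: nP; exists z => //=; rewrite zx.
  + by have := mixed _ _ eS fS ef pe; case; exists w.
  + by rewrite eq_sym in ef; have := mixed _ _ fS eS ef pf; case; exists u.
  + exfalso; have hu : u \in nbrs S v by apply/nbrsP; exists e.
    have hw : w \in nbrs S v by apply/nbrsP; exists f.
    have [auw|awu|auw] := ltgtP (a u) (a w).
    * by apply: (seg_disj _ _ _ auw) su sw; exact: ab.
    * by apply: (seg_disj _ _ _ awu) sw su; exact: ab.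
    * move/eqP: ef; apply; apply: ends_v eu _.
      by rewrite fw (ia _ _ hu hw auw).
Qed.

Lemma opened_at_opp a : opened_at a -> opened_at (fun u => - a u).
Proof.
move=> O; pose phi (x : plane) : plane := (- x.1, x.2).
apply: (@opened_map _ phi setT snd _ _ _ snd _ _ _ _ _ _ _ _ O) => //.
  move=> x _; apply: continuous_pair; last exact: cvg_snd.
  by apply: cvgN; exact: cvg_fst.
move=> x y _ _ [/oppr_inj e1 e2].
by rewrite (surjective_pairing x) (surjective_pairing y) e1 e2.
Qed.

Lemma opened_at_inv a c : {in nbrs S v, forall u, a u != c} ->
  opened_at a -> opened_at (fun u => (a u - c)^-1).
Proof.
move=> ac O; pose z : plane := (c, 0).
apply: (@opened_ext _ _ _ _ _ (inversion z \o (fun u => (a u, 0)))).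
  move=> u unb; rewrite /inversion /sqdist /= subr0 expr0n addr0 mul0r.
  by rewrite expr2 invfM mulrA divff ?mul1r // subr_eq0 ac.
apply: (@opened_map _ _ [set x | x != z] snd _ _ _ snd _ _ _ _ _ _ _ _ O) => //.
- move=> x x0; apply: contraTneq x0 => ->; by rewrite ltxx.
- by move=> u unb /=; rewrite xpair_eqE eqxx andbT ac.
- by move=> x; exact: continuous_inversion.
- by move=> x y; rewrite !inE; exact: inversion_inj.
- move=> x x0; rewrite /inversion /= subr0 divr_gt0 //.
  rewrite lt_neqAle sqdist_ge0 eq_sym sqdist_eq0 andbT.
  by apply: contraTneq x0 => ->; rewrite ltxx.
- by move=> u _; rewrite /inversion /= subrr mul0r.
Qed.

(* If [a y] is not between [a x] and [a z], then the inversion centred at the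
   midpoint of [a x] and [a z] moves it there. *)
Lemma opened_at_card3 a b : simple_vertex v -> (#|nbrs S v| <= 3)%N ->
  {in nbrs S v &, injective b} -> opened_at a -> opened_at b.
Proof.
move=> v_simple card3 ib O.
pose le_b u w := b u <= b w.
pose s := sort le_b (enum (nbrs S v)).
have s_nbrs u : (u \in s) = (u \in nbrs S v) by rewrite mem_sort mem_enum.
have s_uniq : uniq s by rewrite sort_uniq enum_uniq.
have s_sorted : sorted le_b s by apply: sort_sorted => u w; exact: le_total.
have : (size s <= 3)%N by rewrite size_sort -cardE.
have ltb u w : u \in s -> w \in s -> u != w -> le_b u w -> b u < b w.
  rewrite !s_nbrs => hu hw uw; rewrite /le_b le_eqVlt => /orP[/eqP|//].
  by move/(ib _ _ hu hw)/eqP; rewrite (negbTE uw).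
have iso a' : opened_at a' ->
    {in s &, forall u w, a' u < a' w -> b u < b w} -> opened_at b.
  move=> O' h; apply: opened_at_order O' => // u w hu hw.
  by apply: h; rewrite s_nbrs.
have ia := opened_at_inj O.
case: s s_nbrs s_uniq s_sorted ltb iso => [|x [|y [|z []]]] //= s_nbrs.
- by move=> _ _ _ iso _; apply: (iso a).
- move=> _ _ _ iso _; apply: (iso a) => // u w.
  by rewrite !inE => /eqP -> /eqP ->; rewrite ltxx.
- rewrite inE andbT => xy /andP[bxy _] ltb iso _.
  have {}bxy : b x < b y by apply: ltb; rewrite // !inE eqxx ?orbT.
  have [axy|ayx|axy] := ltgtP (a x) (a y).
  + apply: (iso a) => // u w; rewrite !inE.
    by move=> /orP[] /eqP -> /orP[] /eqP ->; rewrite ?ltxx //; lra.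
  + apply: (iso (fun u => - a u)); first exact: opened_at_opp.
    move=> u w; rewrite !inE.
    by move=> /orP[] /eqP -> /orP[] /eqP ->; rewrite ?ltxx //; lra.
  + by move: xy; rewrite (ia x y) ?eqxx // -s_nbrs !inE eqxx ?orbT.
rewrite !inE negb_or !andbT => /andP[/andP[xy xz] yz] /andP[bxy byz] ltb iso _.
have hx : x \in nbrs S v by rewrite -s_nbrs !inE eqxx.
have hy : y \in nbrs S v by rewrite -s_nbrs !inE eqxx orbT.
have hz : z \in nbrs S v by rewrite -s_nbrs !inE eqxx !orbT.
have {}bxy : b x < b y by apply: ltb; rewrite // !inE eqxx ?orbT.
have {}byz : b y < b z by apply: ltb; rewrite // !inE eqxx ?orbT.
have incr a' : opened_at a' -> a' x < a' y -> a' y < a' z -> opened_at b.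
  move=> O' axy ayz; apply: (iso a') => // u w; rewrite !inE.
  move=> /or3P[] /eqP -> /or3P[] /eqP ->; rewrite ?ltxx //; lra.
have decr a' : opened_at a' -> a' z < a' y -> a' y < a' x -> opened_at b.
  by move=> /opened_at_opp O' azy ayx; apply: incr O' _ _; rewrite ltrN2.
have axy : a x != a y by apply: contra_neq xy; exact: ia.
have axz : a x != a z by apply: contra_neq xz; exact: ia.
have ayz : a y != a z by apply: contra_neq yz; exact: ia.
pose c := (a x + a z) / 2.
have Oinv : `|a z - c| < `|a y - c| -> opened_at (fun u => (a u - c)^-1).
  move=> yc; apply: opened_at_inv O => u; rewrite -s_nbrs !inE.
  move=> /or3P[] /eqP ->.
  - by apply: contra_neq axz; rewrite /c; lra.
  - by apply: contraTneq yc => ->; rewrite subrr normr0 -leNgt normr_ge0.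
  - by apply: contra_neq axz; rewrite /c; lra.
have between (q m : R) : 0 < q -> q < `|m| -> - q^-1 < m^-1 < q^-1.
  move=> q0 qm; rewrite -ltr_norml normfV ltf_pV2 // posrE.
  exact: lt_trans qm.
have xc : a x - c = - (a z - c) by rewrite /c; lra.
have [lt_xz|lt_zx|/eqP] := ltgtP (a x) (a z); last by rewrite (negbTE axz).
  have q0 : 0 < a z - c by rewrite /c; lra.
  have [qm|qm] := ltP `|a z - c| `|a y - c|.
    have := Oinv qm; rewrite gtr0_norm // in qm => O'.
    have /andP[h1 h2] := between _ _ q0 qm.
    by apply: incr O' _ _ => //; rewrite xc invrN.
  move: qm; rewrite [`|a z - c|]gtr0_norm // ler_norml => /andP[h1 h2].
  by apply: (incr a) => //; rewrite lt_neqAle ?axy ?ayz /=;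
    move: h1 h2; rewrite /c; lra.
have q0 : 0 < a x - c by rewrite /c; lra.
have zc : a z - c = - (a x - c) by rewrite xc opprK.
have [qm|qm] := ltP `|a z - c| `|a y - c|.
  have := Oinv qm; rewrite zc normrN gtr0_norm // in qm => O'.
  have /andP[h1 h2] := between _ _ q0 qm.
  by apply: decr O' _ _ => //; rewrite zc invrN.
move: qm; rewrite zc normrN [`|a x - c|]gtr0_norm // ler_norml => /andP[h1 h2].
by apply: (decr a) => //; rewrite lt_neqAle 1?eq_sym ?axy ?ayz /=;
  move: h1 h2; rewrite /c; lra.
Qed.
Lemma opened_at_automorphism (g : {perm vertex G}) (t : {perm edge G}) a :
  g v = v -> (forall e, ends (t e) = (g @: ends e)%SET) ->
  (forall e, (t e \in S) = (e \in S)) ->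
  opened_at a -> opened_at (fun u => a (g u)).
Proof.
move=> gv gt tS [pos A ipos gpos far near av ia cr].
have gv_neq u : (g u != v) = (u != v) by rewrite -{1}gv (inj_eq perm_inj).
have g_ends u e : (g u \in ends (t e)) = (u \in ends e).
  by rewrite gt finset.mem_imset //; exact: perm_inj.
have g_set2 u w e : ends e = [set u; w]%SET -> ends (t e) = [set g u; g w]%SET.
  by move=> euw; rewrite gt euw imsetU1 imset_set1.
have g_nbrs u : u \in nbrs S v -> g u \in nbrs S v.
  move=> /nbrsP[e eS eu]; apply/nbrsP; exists (t e); rewrite ?tS //.
  by rewrite (g_set2 _ _ _ eu) gv.
exists (pos \o g) (fun e => A (t e)).
- move=> u w uv wv /=; rewrite -gv_neq in uv; rewrite -gv_neq in wv.
  by move/(ipos _ _ uv wv); exact: perm_inj.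
- by move=> u uv; apply: gpos; rewrite gv_neq.
- move=> e eS ve; have [||[u [w [euw aA]]] pA] := far (t e); rewrite ?tS //.
    by rewrite -gv g_ends.
  split=> //; exists (g^-1 u)%g, (g^-1 w)%g => /=; rewrite !permKV; split=> //.
  apply/setP => x; rewrite -g_ends euw !finset.inE.
  by rewrite !(canF_eq (permK g)) //.
- move=> e u eS eu; have := near (t e) (g u); rewrite tS => /(_ eS) /=; apply.
  by rewrite (g_set2 _ _ _ eu) gv.
- move=> e w eS wv /av; rewrite tS gv_neq g_ends; exact.
- move=> u w hu hw [e]; apply: (@perm_inj _ g).
  by apply: ia; rewrite ?e //; exact: g_nbrs.
- apply: (at_most_image (h := fun c : {set edge G} * plane =>
    ((t @^-1: c.1)%SET, c.2))) cr => -[E y] /=.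
  move=> [e [f [[eS fS ef] [/= -> Ae Af nP]]]].
  exists ([set t e; t f]%SET, y); last first.
    congr (_, _); apply/setP => x; rewrite !finset.inE !(inj_eq perm_inj) //.
  exists (t e), (t f); rewrite !tS (inj_eq perm_inj); split=> //; split=> //=.
  move=> [u /= uv uy]; apply: nP; exists (g^-1 u)%g => /=; rewrite ?permKV //.
  by rewrite -gv_neq permKV.
Qed.

End BoundaryOrder.

Section FreeBoundary.
Variable R : realType.

Lemma perm_on_order (T : finType) (N : {set T}) (a b : T -> R) :
  {in N &, injective b} ->
  exists2 s : {perm T}, perm_on N s &
    {in N &, forall u w, a (s u) < a (s w) -> b u < b w}.
Proof.
move=> ib.
pose le_by (f : T -> R) u w := f u <= f w.
have le_tr f : transitive (le_by f) by move=> x y z; exact: le_trans.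
have le_refl f : reflexive (le_by f) by move=> x; exact: lexx.
pose sorted_by f := sort (le_by f) (enum N).
have srt f : sorted (le_by f) (sorted_by f).
  by apply: sort_sorted => u w; exact: le_total.
have mem f u : (u \in sorted_by f) = (u \in N) by rewrite mem_sort mem_enum.
have unq f : uniq (sorted_by f) by rewrite sort_uniq enum_uniq.
have sz f : size (sorted_by f) = #|N| by rewrite size_sort -cardE.
have idx u : u \in N -> (index u (sorted_by b) < #|N|)%N.
  by rewrite -(sz b) index_mem mem.
pose h u := if u \in N then nth u (sorted_by a) (index u (sorted_by b)) else u.
have hN u : u \in N -> h u \in N.
  by move=> uN; rewrite /h uN -(mem a) mem_nth // sz idx.
have hE u w : w \in N -> h w = nth u (sorted_by a) (index w (sorted_by b)).
  by move=> wN; rewrite /h wN; apply: set_nth_default; rewrite sz idx.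
have ih : injective h.
  move=> u w; have [uN|uN] := boolP (u \in N); have [wN|wN] := boolP (w \in N).
  - rewrite !(hE u) // => /eqP; rewrite nth_uniq ?sz ?idx // => /eqP.
    by move/(congr1 (nth u (sorted_by b))); rewrite !nth_index ?mem.
  - by move=> e; have := hN _ uN; rewrite e {1}/h (negbTE wN) (negbTE wN).
  - by move=> e; have := hN _ wN; rewrite -e {1}/h (negbTE uN) (negbTE uN).
  - by rewrite /h (negbTE uN) (negbTE wN).
exists (perm ih).
  by apply/fintype.subsetP => u; rewrite inE permE /h; case: ifP; rewrite ?eqxx.
move=> u w uN wN; rewrite !permE !(hE u) // => lt_a.
have [le_ix|lt_ix] := leqP (index u (sorted_by b)) (index w (sorted_by b)).
  have := sorted_leq_nth (le_tr b) (le_refl b) u (srt b).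
  move=> /(_ _ _ _ _ le_ix); rewrite !inE !sz !idx // !nth_index ?mem //.
  move=> /(_ isT isT); rewrite /le_by le_eqVlt => /orP[/eqP|//].
  by move/(ib _ _ uN wN) => uw; rewrite uw ltxx in lt_a.
have := sorted_leq_nth (le_tr a) (le_refl a) u (srt a).
move=> /(_ _ _ _ _ (ltnW lt_ix)); rewrite !inE !sz !idx // => /(_ isT isT).
by rewrite /le_by leNgt lt_a.
Qed.

Lemma opened_at_homogeneous (G : multigraph) (v : vertex G) (S : {set edge G}) n
    (a b : vertex G -> R) :
  simple_vertex v -> homogeneous_neighborhood v ->
  (forall e, v \notin ends e -> e \in S) ->
  {in nbrs S v &, injective b} -> opened_at v S n a -> opened_at v S n b.
Proof.
move=> v_simple hom far ib O.
have [s sN ab] := perm_on_order a ib.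
have nbrs_sub : nbrs S v \subset neighborhood v.
  apply/fintype.subsetP => u /nbrsP[e _ eu]; rewrite inE.
  by apply/existsP; exists e; rewrite eu.
have [g] := hom s (fintype.subset_trans sN nbrs_sub).
move=> /setIP[]; rewrite inE => /existsP[t /forallP gt] /astabP gv gs.
have {}gv : g v = v by apply: gv; rewrite inE.
have {}gt e : ends (t e) = (g @: ends e)%SET by exact/eqP.
have in_S e u : ends e = [set u; v]%SET -> (e \in S) = (u \in nbrs S v).
  move=> eu; apply/idP/nbrsP => [eS|[f fS fu]]; first by exists e.
  rewrite (v_simple e f) //; last by rewrite eu fu.
  by rewrite eu !inE eqxx orbT.
have tS e : (t e \in S) = (e \in S).
  have [ve|ve] := boolP (v \in ends e); last first.
    rewrite !far // gt; apply: contra ve => /imsetP[w we vw].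
    by rewrite (_ : v = w) //; apply: (@perm_inj _ g); rewrite gv.
  have [u uv eu] := ends_other ve.
  have teu : ends (t e) = [set g u; v]%SET.
    by rewrite gt eu imsetU1 imset_set1 gv.
  rewrite (in_S _ _ eu) (in_S _ _ teu) gs ?perm_closed //.
  by rewrite inE; apply/existsP; exists e; rewrite eu.
apply: (opened_at_order v_simple _ (opened_at_automorphism gv gt tS O)).
move=> u w uN wN; rewrite !gs; [exact: ab| |];
  exact: (fintype.subsetP nbrs_sub).
Qed.

End FreeBoundary.

Lemma sub_set2 (T : finType) (P : pred T) a b (Pa : P a) (Pb : P b) :
  [set u : {u | P u} | val u \in [set a; b]%SET]%SET =
  [set (Sub a Pa : {u | P u}); (Sub b Pb : {u | P u})]%SET.
Proof. by apply/setP => u; rewrite !finset.inE -!val_eqE. Qed.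

Section Gluing.
Variable R : realType.
Local Notation plane := (R * R)%type.
Variables (G1 G2 : multigraph) (v1 : vertex G1) (v2 : vertex G2).
Variable sigma : {u | u \in neighborhood v1} -> {u | u \in neighborhood v2}.

Definition zip_left (f : zip_edge v1 v2) (e : edge G1) : bool :=
  match f with
  | inl (inl e1) => e == val e1
  | inl (inr _) => false
  | inr u => ends e == [set val u; v1]%SET
  end.

Definition zip_right (f : zip_edge v1 v2) (e : edge G2) : bool :=
  match f with
  | inl (inl _) => false
  | inl (inr e2) => e == val e2
  | inr u => ends e == [set val (sigma u); v2]%SET
  end.

Lemma nbr_set2_inl (G : multigraph) (v : vertex G)
    (u w : {u | u \in neighborhood v}) (e : edge G) :
  ends e = [set val u; v]%SET -> ends e = [set val w; v]%SET -> u = w.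
Proof.
move=> eu ew; apply/val_inj/(@set2_inl _ _ _ v); first by rewrite -eu.
exact: neighborhood_neq (valP u).
Qed.

Lemma zip_left_inj f f' e : zip_left f e -> zip_left f' e -> f = f'.
Proof.
have no (e1 : {e : edge G1 | v1 \notin ends e}) u :
    ends (val e1) = [set u; v1]%SET -> False.
  by move=> eu; have := valP e1; rewrite eu !finset.inE eqxx orbT.
case: f f' => [[e1|e1]|u] [[e2|e2]|u'] //=.
- by move=> /eqP -> /eqP /val_inj ->.
- by move=> /eqP -> /eqP /no.
- by move=> + /eqP e12; rewrite e12 => /eqP /no.
- by move=> /eqP eu /eqP eu'; rewrite (nbr_set2_inl eu eu').
Qed.

Hypothesis sigma_inj : injective sigma.

Lemma zip_right_inj f f' e : zip_right f e -> zip_right f' e -> f = f'.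
Proof.
have no (e1 : {e : edge G2 | v2 \notin ends e}) u :
    ends (val e1) = [set u; v2]%SET -> False.
  by move=> eu; have := valP e1; rewrite eu !finset.inE eqxx orbT.
case: f f' => [[e1|e1]|u] [[e2|e2]|u'] //=.
- by move=> /eqP -> /eqP /val_inj ->.
- by move=> /eqP -> /eqP /no.
- by move=> + /eqP e12; rewrite e12 => /eqP /no.
- by move=> /eqP eu /eqP eu'; rewrite (sigma_inj (nbr_set2_inl eu eu')).
Qed.

Lemma zip_left_ends f e (w : {u | u != v1}) : zip_left f e ->
  val w \in ends e -> inl w \in zip_ends sigma f.
Proof.
case: f => [[e1|//]|u] /= /eqP.
  by move=> -> we; apply/imsetP; exists w; rewrite ?finset.inE.
move=> ->; rewrite !finset.inE (negbTE (valP w)) orbF => /eqP wu.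
by rewrite /= wu eqxx.
Qed.

Lemma zip_right_ends f e (w : {u | u != v2}) : zip_right f e ->
  val w \in ends e -> inr w \in zip_ends sigma f.
Proof.
case: f => [[//|e1]|u] /= /eqP.
  by move=> -> we; apply/imsetP; exists w; rewrite ?finset.inE.
move=> ->; rewrite !finset.inE (negbTE (valP w)) orbF => /eqP wu.
by apply/orP; right; apply/eqP; congr inr; apply: val_inj.
Qed.

Lemma drawn_zip (S : {set zip_edge v1 v2}) (S1 : {set edge G1})
    (S2 : {set edge G2}) (g : plane -> R) b1 b2 n1 n2 :
  simple_vertex v1 -> simple_vertex v2 ->
  (forall f, f \in S -> (exists2 e, e \in S1 & zip_left f e) \/
                        (exists2 e, e \in S2 & zip_right f e)) ->
  (forall u, inr u \in S -> (exists2 e, e \in S1 & zip_left (inr u) e) /\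
                            (exists2 e, e \in S2 & zip_right (inr u) e)) ->
  (forall u, b1 (val u) = b2 (val (sigma u))) ->
  opened v1 S1 g b1 n1 -> opened v2 S2 (fun x => - g x) b2 n2 ->
  @drawn R (zip_product sigma) S (n1 + n2).
Proof.
move=> v1_simple v2_simple SE Sinr b12.
move=> [pos1 A1 ipos1 gpos1 far1 near1 av1 ib1 cr1].
move=> [pos2 A2 ipos2 gpos2 far2 near2 av2 ib2 cr2].
pose pos (w : zip_vertex v1 v2) : plane :=
  match w with inl u => pos1 (val u) | inr u => pos2 (val u) end.
pose A (f : zip_edge v1 v2) : set plane :=
  [set x | exists e, [/\ e \in S1, zip_left f e & A1 e x]] `|`
  [set x | exists e, [/\ e \in S2, zip_right f e & A2 e x]].
have A1g e x : e \in S1 -> A1 e x -> 0 < g x \/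
    exists u, [/\ ends e = [set u; v1]%SET, x = b1 u & g x = 0].
  move=> eS Ax; have [ve|ve] := boolP (v1 \in ends e); last first.
    by left; have [_ h] := far1 _ eS ve; exact: h.
  have [u uv eu] := ends_other ve; have [_ g0 h] := near1 _ _ eS eu.
  by have [->|gx] := h _ Ax; [right; exists u|left].
have A2g e x : e \in S2 -> A2 e x -> g x < 0 \/
    exists u, [/\ ends e = [set u; v2]%SET, x = b2 u & g x = 0].
  move=> eS Ax; have [ve|ve] := boolP (v2 \in ends e); last first.
    by left; have [_ h] := far2 _ eS ve; rewrite -oppr_gt0; exact: h.
  have [u uv eu] := ends_other ve; have [_ g0 h] := near2 _ _ eS eu.
  have [->|gx] := h _ Ax; last by left; rewrite -oppr_gt0.
  by right; exists u; split => //; apply/eqP; rewrite -oppr_eq0 g0.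
have mixed f f' e e' x : f \in S -> e \in S1 -> e' \in S2 -> zip_left f e ->
    zip_right f' e' -> A1 e x -> A2 e' x -> f = f'.
  move=> fS eS e'S fe fe' /(A1g _ _ eS) h /(A2g _ _ e'S) h'.
  have [u [eu xu gx]] :
      exists u, [/\ ends e = [set u; v1]%SET, x = b1 u & g x = 0].
    by case: h => // gx; case: h' => [|[u [_ _ g0]]]; lra.
  case: h' => [|[u' [eu' xu' _]]]; first by rewrite gx ltxx.
  case: f fe fS => [[e1|//]|w] /= /eqP we fS.
    by have := valP e1; rewrite /= -we eu !finset.inE eqxx orbT.
  case: f' fe' => [[//|e2]|w'] /= /eqP we'.
    by have := valP e2; rewrite /= -we' eu' !finset.inE eqxx orbT.
  congr inr; apply/sigma_inj/val_inj; apply: ib2.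
  - by have [_ [e2 e2S /eqP ew]] := Sinr _ fS; apply/nbrsP; exists e2.
  - by apply/nbrsP; exists e'.
  - have uw : u = val w.
      apply: (@set2_inl _ _ _ v1); first by rewrite -eu.
      by have := card_ends e; rewrite eu cards2; case: eqP.
    have uw' : u' = val (sigma w').
      apply: (@set2_inl _ _ _ v2); first by rewrite -eu'.
      by have := card_ends e'; rewrite eu' cards2; case: eqP.
    by rewrite -b12 -uw -xu xu' uw'.
exists pos A.
- move=> [u|u] [w|w] /=.
  + by move/(ipos1 _ _ (valP u) (valP w))/val_inj => ->.
  + move=> e; have := gpos1 _ (valP u); have := gpos2 _ (valP w).
    by rewrite e oppr_gt0 => h1 h2; have := lt_trans h1 h2; rewrite ltxx.
  + move=> e; have := gpos2 _ (valP u); have := gpos1 _ (valP w).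
    by rewrite -e oppr_gt0 => h1 h2; have := lt_trans h1 h2; rewrite ltxx.
  + by move/(ipos2 _ _ (valP u) (valP w))/val_inj => ->.
- move=> [[e|e]|u] fS.
  + have [[e' e'S /= /eqP ee']|[]//] := SE _ fS; rewrite {}ee' in e'S.
    have -> : A (inl (inl e)) = A1 (val e).
      apply/seteqP; split => x; first by case=> -[e0 [_ // /eqP ->]].
      by move=> Ax; left; exists (val e); rewrite /= eqxx.
    have [[u [w [euw aA]]] _] := far1 _ e'S (valP e).
    have uv : u != v1
      by apply: contraNneq (valP e) => u_v; rewrite /= euw u_v !finset.inE eqxx.
    have wv : w != v1.
      apply: contraNneq (valP e) => w_v.
      by rewrite /= euw w_v !finset.inE eqxx orbT.
    exists (inl (Sub u uv)), (inl (Sub w wv)); split=> //=.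
    by rewrite euw (sub_set2 (P := fun u => u != v1) uv wv) imsetU1 imset_set1.
  + have [[]//|[e' e'S /= /eqP ee']] := SE _ fS; rewrite {}ee' in e'S.
    have -> : A (inl (inr e)) = A2 (val e).
      apply/seteqP; split => x; first by case=> -[e0 [_ // /eqP ->]].
      by move=> Ax; right; exists (val e); rewrite /= eqxx.
    have [[u [w [euw aA]]] _] := far2 _ e'S (valP e).
    have uv : u != v2
      by apply: contraNneq (valP e) => u_v; rewrite /= euw u_v !finset.inE eqxx.
    have wv : w != v2.
      apply: contraNneq (valP e) => w_v.
      by rewrite /= euw w_v !finset.inE eqxx orbT.
    exists (inr (Sub u uv)), (inr (Sub w wv)); split=> //=.
    by rewrite euw (sub_set2 (P := fun u => u != v2) uv wv) imsetU1 imset_set1.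
  + have [[e1 e1S /= /eqP eu1] [e2 e2S /= /eqP eu2]] := Sinr _ fS.
    have -> : A (inr u) = A1 e1 `|` A2 e2.
      rewrite /A; congr (_ `|` _); apply/seteqP; split => x /=.
      - move=> [e [_ /eqP eu]]; rewrite (v1_simple e e1) //; last by rewrite eu.
        by rewrite eu !finset.inE eqxx orbT.
      - by move=> Ax; exists e1; rewrite eu1 eqxx.
      - move=> [e [_ /eqP eu]]; rewrite (v2_simple e e2) //; last by rewrite eu.
        by rewrite eu !finset.inE eqxx orbT.
      - by move=> Ax; exists e2; rewrite eu2 eqxx.
    have [a1 g1 p1] := near1 _ _ e1S eu1; have [a2 g2 p2] := near2 _ _ e2S eu2.
    exists (inl (Sub (val u) (neighborhood_neq (valP u)))).
    exists (inr (Sub (val (sigma u)) (neighborhood_neq (valP (sigma u))))).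
    split=> //=; apply: arc_cat a1 _ _.
      by rewrite b12; exact: arc_sym.
    move=> x /p1[//|gx] /p2[->|]; first by rewrite b12.
    by rewrite oppr_gt0 => gx'; have := lt_trans gx gx'; rewrite ltxx.
- move=> f [w|w] fS [[e [eS fe Ax]]|[e [eS fe Ax]]].
  + by apply: zip_left_ends fe _; apply: av1 Ax => //; exact: valP w.
  + have := gpos1 _ (valP w); have [|[u [_ _ ->]]] := A2g _ _ eS Ax; last first.
      by rewrite ltxx.
    by move=> h1 h2; have := lt_trans h1 h2; rewrite ltxx.
  + have := gpos2 _ (valP w); rewrite oppr_gt0.
    have [|[u [_ _ ->]]] := A1g _ _ eS Ax; last by rewrite ltxx.
    by move=> h1 h2; have := lt_trans h1 h2; rewrite ltxx.
  + by apply: zip_right_ends fe _; apply: av2 Ax => //; exact: valP w.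
pose h1 (c : {set edge G1} * plane) : {set zip_edge v1 v2} * plane :=
  ([set f | [exists e in c.1, zip_left f e]]%SET, c.2).
pose h2 (c : {set edge G2} * plane) : {set zip_edge v1 v2} * plane :=
  ([set f | [exists e in c.1, zip_right f e]]%SET, c.2).
have cr1' := at_most_image (h := h1) (@subset_refl _ _) cr1.
have cr2' := at_most_image (h := h2) (@subset_refl _ _) cr2.
have [s sn sP] := at_most_setU cr1' cr2'.
exists s => // -[E x] C; apply: sP.
move: C => [f [f' [[fS f'S ff'] [/= -> Af Af' nP]]]].
case: Af Af' => [[e [eS fe Ax]]|[e [eS fe Ax]]]
  [[e' [e'S fe' Ax']]|[e' [e'S fe' Ax']]].
- left; exists ([set e; e']%SET, x).
    exists e, e'; split; split=> //=.
      by apply: contra_neq ff' => ee'; apply: zip_left_inj fe _; rewrite ee'.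
    move=> [u uv ux]; apply: nP; exists (inl (Sub u uv)) => //=.
  congr (_, _); apply/setP => f0; rewrite !finset.inE /=; apply/existsP/orP.
    move=> [e0 /andP[]]; rewrite !finset.inE => /orP[] /eqP -> fe0.
      by left; rewrite (zip_left_inj fe0 fe).
    by right; rewrite (zip_left_inj fe0 fe').
  by case=> /eqP ->; [exists e|exists e']; rewrite !finset.inE eqxx ?orbT.
- by rewrite (mixed _ _ _ _ _ fS eS e'S fe fe' Ax Ax') eqxx in ff'.
- by rewrite (mixed _ _ _ _ _ f'S e'S eS fe' fe Ax' Ax) eqxx in ff'.
- right; exists ([set e; e']%SET, x).
    exists e, e'; split; split=> //=.
      by apply: contra_neq ff' => ee'; apply: zip_right_inj fe _; rewrite ee'.
    move=> [u uv ux]; apply: nP; exists (inr (Sub u uv)) => //=.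
  congr (_, _); apply/setP => f0; rewrite !finset.inE /=; apply/existsP/orP.
    move=> [e0 /andP[]]; rewrite !finset.inE => /orP[] /eqP -> fe0.
      by left; rewrite (zip_right_inj fe0 fe).
    by right; rewrite (zip_right_inj fe0 fe').
  by case=> /eqP ->; [exists e|exists e']; rewrite !finset.inE eqxx ?orbT.
Qed.

End Gluing.

Section DrawingsExist.
Variable R : realType.
Local Notation plane := (R * R)%type.

Lemma quadratic_roots (a b c : R) : a != 0 ->
  exists s : seq R, forall x, a * x ^+ 2 + b * x + c = 0 -> x \in s.
Proof.
move=> a0; pose d := Num.sqrt (b ^+ 2 - 4 * a * c).
exists [:: (- b + d) / (2 * a); (- b - d) / (2 * a)] => x e.
have a2 : 2 * a != 0 by rewrite mulf_neq0 ?pnatr_eq0.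
have dE : d = `|2 * a * x + b|.
  rewrite /d -sqrtr_sqr; congr Num.sqrt.
  have -> : c = - (a * x ^+ 2 + b * x) by lra.
  by ring.
rewrite !inE; have [h|h] := lerP 0 (2 * a * x + b).
  apply/orP; left; apply/eqP/(mulIf a2); rewrite mulfVK // dE ger0_norm //.
  by ring.
apply/orP; right; apply/eqP/(mulIf a2); rewrite mulfVK // dE ltr0_norm //.
by ring.
Qed.

(* Vertices on a line, and edges along parabolas with distinct leading
   coefficients, so that two edges have at most two common points. *)
Lemma drawn_exists (G : multigraph) : exists n, @drawn R G [set: edge G]%SET n.
Proof.
pose p (u : vertex G) : R := (enum_rank u)%:R.
have ip : injective p.
  by move=> u w /eqP; rewrite eqr_nat => /eqP/val_inj/enum_rank_inj.
pose l (e : edge G) : R := (enum_rank e).+1%:R.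
have il : injective l.
  by move=> e f /eqP; rewrite eqr_nat eqSS => /eqP/val_inj/enum_rank_inj.
have l0 e : l e != 0 by rewrite pnatr_eq0.
have h e : exists uw : vertex G * vertex G,
    uw.1 != uw.2 /\ ends e = [set uw.1; uw.2]%SET.
  have /eqP/cards2P[u [w [uw euw]]] := card_ends e.
  by exists (u, w).
have [uw uwE] := choice h.
pose q e x := l e * (x - p (uw e).1) * (p (uw e).2 - x).
pose x_ e t := p (uw e).1 + t * (p (uw e).2 - p (uw e).1).
pose c e t : plane := (x_ e t, q e (x_ e t)).
have d0 e : p (uw e).2 - p (uw e).1 != 0.
  by rewrite subr_eq0 (inj_eq ip) eq_sym; have [] := uwE e.
have ic e : injective (c e).
  by move=> s t [/addrI /(mulIf (d0 e))].
have c0 e : c e 0 = (p (uw e).1, 0).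
  by rewrite /c /q /x_; congr (_, _); ring.
have c1 e : c e 1 = (p (uw e).2, 0).
  by rewrite /c /q /x_; congr (_, _); ring.
have cc e : continuous (c e).
  have cx : continuous (x_ e).
    move=> t; apply: cvgD; first exact: cvg_cst.
    by apply: cvgM; [exact: cvg_id|exact: cvg_cst].
  move=> t; apply: (@continuous_pair R R (x_ e) (q e \o x_ e)); first exact: cx.
  apply: cvgM; last by apply: cvgB; [exact: cvg_cst|exact: cx].
  by apply: cvgM; [exact: cvg_cst|apply: cvgB; [exact: cx|exact: cvg_cst]].
pose A e := c e @` `[0, 1]%classic.
have AE e x : A e x -> x.2 = q e x.1 by case=> t _ <-.
have roots e f : exists s : seq R, e != f ->
    forall x, A e x -> A f x -> x.1 \in s.
  have [<-|ef] := eqVneq e f; first by exists [::].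
  have lef : l f - l e != 0 by rewrite subr_eq0 (inj_eq il) eq_sym.
  pose s1 e := p (uw e).1 + p (uw e).2; pose s2 e := p (uw e).1 * p (uw e).2.
  have [s sP] := quadratic_roots (l e * s1 e - l f * s1 f)
                   (l f * s2 f - l e * s2 e) lef.
  exists s => _ x /AE xe /AE xf; apply: sP.
  have : q e x.1 = q f x.1 by rewrite -xe -xf.
  by rewrite /q /s1 /s2; lra.
have roots2 (ef : edge G * edge G) : exists s : seq R, ef.1 != ef.2 ->
    forall x, A ef.1 x -> A ef.2 x -> x.1 \in s by exact: roots.
have [s sP] := choice roots2.
pose pts (ef : edge G * edge G) : seq ({set edge G} * plane) :=
  [seq ([set ef.1; ef.2]%SET, (x, q ef.1 x)) | x <- s ef].
exists (size (flatten [seq pts ef | ef <- enum {: edge G * edge G}])).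
exists (fun u => (p u, 0)) A.
- by move=> u w [/ip].
- move=> e _; exists (uw e).1, (uw e).2; split; first by have [] := uwE e.
  rewrite -c0 -c1; exists (c e); split=> //.
    by apply: continuous_subspaceT; exact: cc.
  by move=> x y _ _; exact: ic.
- move=> e w _ /AE /= /esym/eqP; rewrite /q !mulf_eq0 (negbTE (l0 e)) /=.
  have [_ ->] := uwE e; rewrite !subr_eq0 !(inj_eq ip) !finset.inE.
  by rewrite [_ == w]eq_sym.
exists (flatten [seq pts ef | ef <- enum {: edge G * edge G}]) => // -[E x].
move=> [e [f [[_ _ ef] [/= -> Ae Af _]]]]; apply/flattenP; exists (pts (e, f)).
  by apply: map_f; rewrite mem_enum.
apply/mapP; exists x.1; first exact: (sP (e, f)).
by rewrite /= -(AE _ _ Ae) -surjective_pairing.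
Qed.
End DrawingsExist.

Section Conversions.
Variable R : realType.
Local Notation plane := (R * R)%type.

Lemma at_most_card (T : choiceType) (X : set T) n :
  at_most X n -> exists2 m, (m <= n)%N & (X #= `I_m)%card.
Proof.
move=> [s sn Xs].
have fX : finite_set X.
  by apply: (sub_finite_set (B := [set` s])) => //; exact: finite_seq.
exists (size (finmap.enum_fset (fset_set X))); last first.
  by rewrite -{1}(fset_setK fX); apply/card_eq_fsetP.
apply: leq_trans sn; apply: uniq_leq_size; first exact: finmap.fset_uniq.
by move=> x; rewrite in_fset_set // inE => /Xs.
Qed.

Lemma card_at_most (T : choiceType) (X : set T) n :
  (X #= `I_n)%card -> at_most X n.
Proof.
move=> Xn; have fX : finite_set X by exists n.
exists (finmap.enum_fset (fset_set X)); last by move=> x Xx; rewrite in_fset_set // inE.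
by move: Xn; rewrite -{1}(fset_setK fX) => /card_eq_fsetP <-.
Qed.

Lemma drawable_drawn (G : multigraph) n :
  drawable_with R G n -> drawn R [set: edge G]%SET n.
Proof.
move=> [D Dn]; pose A e := curve D e @` `[0, 1]%classic.
have i0 : 0 \in `[0, 1 : R] by rewrite in_itv /= lexx ler01.
have i1 : 1 \in `[0, 1 : R] by rewrite in_itv /= lexx ler01.
have ic e s t : s \in `[0, 1] -> t \in `[0, 1] ->
    curve D e s = curve D e t -> s = t.
  by move=> hs ht; apply: (@curve_inj _ _ D e); rewrite inE.
have oo (t : R) : t \in `[0, 1] -> [\/ t = 0, t = 1 | t \in `]0, 1[].
  rewrite !in_itv /= => /andP[]; rewrite !le_eqVlt.
  move=> /orP[/eqP <-|t0]; first by constructor 1.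
  by move=> /orP[/eqP ->|t1]; [constructor 2|constructor 3; rewrite t0 t1].
have posE e t : t = 0 \/ t = 1 ->
    exists2 u, u \in ends e & curve D e t = position D u.
  move=> t01; have : [set curve D e 0; curve D e 1] (curve D e t).
    by case: t01 => ->; [left|right].
  by rewrite curve_ends => -[u /= ue <-]; exists u.
have Apos e w : A e (position D w) -> w \in ends e.
  move=> [t /= /oo t01 tw].
  have [t0|t0] : (t = 0 \/ t = 1) \/ t \in `]0, 1[.
  - by case: t01 => ?; [left; left|left; right|right].
  - by have [u ue uw] := posE e t t0; rewrite -(@position_inj _ _ D u w) // -uw.
  - by exfalso; apply: (@curve_avoid _ _ D e w t) tw; rewrite inE.
exists (position D) A => //.
- exact: position_inj.
- move=> e _; have aA : arc (curve D e 0) (curve D e 1) (A e).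
    exists (curve D e); split=> //; first exact: curve_continuous.
    by move=> s t; exact: ic.
  have [|u ue c0] := posE e 0; first by left.
  have [|w we c1] := posE e 1; first by right.
  exists u, w; rewrite -c0 -c1; split=> //.
  have uw : u != w.
    by have [_ _] := arc_ends aA; rewrite c0 c1; apply: contra_neq => ->.
  apply/esym/eqP; rewrite eqEcard card_ends cards2 uw andbT.
  by rewrite finset.subUset !finset.sub1set ue we.
- by move=> e w _; exact: Apos.
have [s sn sP] := card_at_most Dn; exists s => // -[E x].
move=> [e [f [[_ _ ef] [/= -> [t /= /oo t01 tx] [t' /= /oo t01' tx'] nP]]]].
apply: sP; exists e, f; split=> //=.
  case: t01 => t0; [| |by exists t => //=; rewrite ?inE];
    have [|u _ ue] := posE e t; auto; exfalso; apply: nP; exists u => //;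
    by rewrite -ue.
case: t01' => t0; [| |by exists t' => //=; rewrite ?inE];
  have [|u _ ue] := posE f t'; auto; exfalso; apply: nP; exists u => //;
  by rewrite -ue.
Qed.

Lemma drawn_drawable (G : multigraph) n :
  drawn R [set: edge G]%SET n -> exists2 m, (m <= n)%N & drawable_with R G m.
Proof.
move=> [pos A ipos Aarc av cr].
have h e : exists ce : R -> plane,
    [/\ {within `[0, 1]%classic, continuous ce},
        {in `[0, 1] &, injective ce},
        [set ce 0; ce 1] = pos @` [set` ends e] & ce @` `[0, 1]%classic = A e].
  have [|u [w [euw [c [cc ic c0 c1 cA]]]]] := Aarc e.
    by rewrite finset.inE.
  exists c; split=> //; rewrite c0 c1 euw; apply/seteqP; split=> x /=.
    by case=> ->; [exists u|exists w]; rewrite //= !finset.inE eqxx ?orbT.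
  by move=> [y /=]; rewrite !finset.inE => /orP[]/eqP -> <-; [left|right].
have [c cP] := choice h.
have i0 : 0 \in `[0, 1 : R] by rewrite in_itv /= lexx ler01.
have i1 : 1 \in `[0, 1 : R] by rewrite in_itv /= lexx ler01.
have sub (t : R) : t \in `]0, 1[ -> t \in `[0, 1] by exact: subset_itvW.
have avoid e w (t : R) : t \in `]0, 1[ -> c e t <> pos w.
  move=> t01 tw; have [_ ic cE cA] := cP e.
  have we : w \in ends e.
    by apply: av; rewrite ?finset.inE // -cA -tw; exists t => //; exact: sub.
  have : [set c e 0; c e 1] (c e t) by rewrite cE tw; exists w.
  move: (t01); rewrite in_itv /= => /andP[t0 t1].
  by case=> /(ic _ _ (sub _ t01)) => [/(_ i0)|/(_ i1)] e1;
    move: t0 t1; rewrite e1 ltxx.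
have cc e := let: And4 h _ _ _ := cP e in h.
have cE e := let: And4 _ _ h _ := cP e in h.
have ic e : {in `[0, 1]%classic &, injective (c e)}.
  by move=> s t; rewrite !inE; have [_ ic _ _] := cP e; exact: ic.
have cv e v (t : R) : t \in `]0, 1[%classic -> c e t <> pos v.
  by rewrite inE; exact: avoid.
pose D := Drawing ipos cc ic cE cv.
have [s sn sP] := cr.
have [|m mn Dm] := @at_most_card _ (crossings D) n.
  exists s => // -[E x] [e [f [ef /= -> [t t01 tx] [t' t01' tx']]]].
  apply: sP; exists e, f; rewrite !finset.inE; split=> //; split=> //=.
  - by have [_ _ _ <-] := cP e; exists t => //; exact: sub.
  - by have [_ _ _ <-] := cP f; exists t' => //; exact: sub.
  - by move=> [w _ wx]; apply: (avoid e w t); rewrite ?wx.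
by exists m => //; exists D.
Qed.

Lemma drawn_crossing_number (G : multigraph) :
  drawn R [set: edge G]%SET (crossing_number R G).
Proof.
apply: drawable_drawn; have [n /drawn_drawable[m _ Gm]] := drawn_exists R G.
rewrite /crossing_number; case: xgetP => [k _ [] //|no].
have ex : exists k, `[< drawable_with R G k >] by exists m; apply/asboolP.
case: (no (ex_minn ex)); case: ex_minnP => k /asboolP Gk k_min; split=> //.
by move=> k' /asboolP; exact: k_min.
Qed.

Lemma crossing_number_le (G : multigraph) n :
  drawn R [set: edge G]%SET n -> (crossing_number R G <= n)%N.
Proof.
move=> /drawn_drawable[m mn Gm]; rewrite /crossing_number.
case: xgetP => // k _ [_ k_min]; exact: leq_trans (k_min _ Gm) mn.
Qed.

Lemma drawn_del_edge (G : multigraph) (e : edge G) n :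
  drawn R [set: edge (del_edge e)]%SET n -> drawn R [set~ e]%SET n.
Proof.
move=> [pos A ipos Aarc av cr].
pose B (f : edge G) : set plane :=
  if insub f is Some f' then A f' else set0.
have BE (f : edge G) (fe : f != e) : B f = A (Sub f fe).
  by rewrite /B insubT.
apply: (@Drawn _ G _ _ pos B) => //.
- move=> f; rewrite !finset.inE => fe; rewrite (BE _ fe).
  have [|u [w [/= ee a]]] := Aarc (Sub f fe); first by rewrite finset.inE.
  by exists u, w.
- move=> f w; rewrite !finset.inE => fe; rewrite (BE _ fe) => /av.
  by rewrite finset.inE => /(_ isT).
- apply: (at_most_image (h := fun c : {set edge (del_edge e)} * plane =>
    ((val @: c.1)%SET, c.2))) cr => -[E x].
  move=> [f [f' [[]]]]; rewrite !finset.inE => fe f'e ff' /= [->].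
  rewrite (BE _ fe) (BE _ f'e) => Af Af' nP.
  exists ([set (Sub f fe : {f | f != e}); (Sub f' f'e : {f | f != e})]%SET, x).
    exists (Sub f fe), (Sub f' f'e); rewrite !finset.inE; split=> //.
  by rewrite /= imsetU1 imset_set1.
Qed.

Lemma del_edge_drawn (G : multigraph) (e : edge G) n :
  drawn R [set~ e]%SET n -> drawn R [set: edge (del_edge e)]%SET n.
Proof.
move=> [pos A ipos Aarc av cr].
apply: (@Drawn _ (del_edge e) _ _ pos (fun f : {f | f != e} => A (val f))) => //.
- move=> f _; have [|u [w [ee a]]] := Aarc (val f).
    by rewrite !finset.inE (valP f).
  by exists u, w.
- by move=> f w _; apply: av; rewrite !finset.inE (valP f).
- apply: (at_most_image (h := fun c : {set edge G} * plane =>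
    ((val @^-1: c.1)%SET : {set edge (del_edge e)}, c.2))) cr => -[E x].
  move=> [f [f' [[_ _ ff'] /= [-> Af Af' nP]]]].
  exists ([set val f; val f']%SET, x).
    exists (val f), (val f'); rewrite !finset.inE !(valP f) !(valP f'); split=> //.
  by congr (_, _); apply/setP => f0; rewrite !finset.inE -!val_eqE.
Qed.
End Conversions.

Section FreeVertices.
Variable R : realType.
Local Notation plane := (R * R)%type.

(* The drawings opened at [v] realize every order of the neighbours of [v] on
   the boundary. *)
Definition free_vertex (G : multigraph) (v : vertex G) (S : {set edge G}) :=
  forall n (a b : vertex G -> R), {in nbrs S v &, injective b} ->
    opened_at v S n a -> opened_at v S n b.

Lemma card_nbrs (G : multigraph) (v : vertex G) (S : {set edge G}) :
  (#|nbrs S v| <= degree v)%N.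
Proof.
pose f u := [pick e in S | ends e == [set u; v]%SET].
have fE u : u \in nbrs S v -> exists2 e, f u = Some e & ends e = [set u; v]%SET.
  move=> /nbrsP[e eS eu]; rewrite /f; case: pickP => [e' /andP[_ /eqP ?]|/(_ e)].
    by exists e'.
  by rewrite eS eu eqxx.
have f_inj : {in nbrs S v &, injective f}.
  move=> u w /fE[e -> eu] /fE[e' -> e'w] [ee'].
  apply: (@set2_inl _ _ _ v); first by rewrite -eu ee'.
  by have := card_ends e; rewrite eu cards2; case: eqP.
rewrite -(card_in_imset f_inj) /degree -[leqRHS](card_imset _ Some_inj).
apply/subset_leq_card/fintype.subsetP => _ /imsetP[u /fE[e -> eu] ->].
by apply: imset_f; rewrite finset.inE eu !finset.inE eqxx orbT.
Qed.

Lemma free_vertexP (G : multigraph) (v : vertex G) (S : {set edge G}) d :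
  simple_vertex v -> degree v = d ->
  (d <> 3 -> homogeneous_neighborhood v) ->
  (forall e, v \notin ends e -> e \in S) -> free_vertex v S.
Proof.
move=> v_simple vd hom far n a b ib O; have [d3|/eqP d3] := eqVneq d 3.
  by apply: opened_at_card3 ib O; rewrite // (leq_trans (card_nbrs _ _)) // vd d3.
exact: opened_at_homogeneous (hom d3) far ib O.
Qed.
End FreeVertices.

Section CrossingNumberOfZipProduct.
Variable R : realType.
Local Notation plane := (R * R)%type.
Variables (G1 G2 : multigraph) (v1 : vertex G1) (v2 : vertex G2).
Variable sigma : {u | u \in neighborhood v1} -> {u | u \in neighborhood v2}.
Hypothesis v1_simple : simple_vertex v1.
Hypothesis v2_simple : simple_vertex v2.
Hypothesis sigma_bij : bijective sigma.

Lemma nbrs_neighborhood (G : multigraph) (v u : vertex G) (S : {set edge G}) :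
  u \in nbrs S v -> u \in neighborhood v.
Proof.
by move=> /nbrsP[e _ eu]; rewrite finset.inE; apply/existsP; exists e; rewrite eu.
Qed.

Lemma drawn_zip_free (S : {set zip_edge v1 v2}) (S1 : {set edge G1})
    (S2 : {set edge G2}) n1 n2 :
  (forall e, inl (inl e) \in S -> val e \in S1) ->
  (forall e, inl (inr e) \in S -> val e \in S2) ->
  (forall u, inr u \in S -> val u \in nbrs S1 v1) ->
  (forall u, (val u \in nbrs S1 v1) = (val (sigma u) \in nbrs S2 v2)) ->
  free_vertex R v1 S1 \/ free_vertex R v2 S2 ->
  drawn R S1 n1 -> drawn R S2 n2 ->
  @drawn R (zip_product sigma) S (n1 + n2).
Proof.
move=> SS1 SS2 Sinr nbrs12 free D1 D2.
have [a1 O1] := opened_halfplane v1_simple D1.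
have [a2 O2] := opened_halfplane v2_simple D2.
have [tau sigmaK tauK] := sigma_bij.
have [b1 [b2 [b12 O1' O2']]] : exists (b1 : vertex G1 -> R)
    (b2 : vertex G2 -> R), [/\ forall u, b1 (val u) = b2 (val (sigma u)),
    opened_at v1 S1 n1 b1 & opened_at v2 S2 n2 b2].
  case: free => free.
    pose b u : R := if insub u is Some u' then a2 (val (sigma u')) else 0.
    have bE (u : {u | u \in neighborhood v1}) : b (val u) = a2 (val (sigma u)).
      by rewrite /b valK.
    exists b, a2; split=> //; apply: (free n1 a1) => // u w hu hw.
    pose u' : {u | u \in neighborhood v1} := Sub u (nbrs_neighborhood hu).
    pose w' : {u | u \in neighborhood v1} := Sub w (nbrs_neighborhood hw).
    rewrite (bE u') (bE w') => /(opened_at_inj O2); rewrite -!nbrs12.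
    by move=> /(_ hu hw)/val_inj/(can_inj sigmaK)/(congr1 val).
  pose b u : R := if insub u is Some u' then a1 (val (tau u')) else 0.
  have bE (u : {u | u \in neighborhood v2}) : b (val u) = a1 (val (tau u)).
    by rewrite /b valK.
  exists a1, b; split=> // [u|]; first by rewrite bE sigmaK.
  apply: (free n2 a2) => // u w hu hw.
  pose u' : {u | u \in neighborhood v2} := Sub u (nbrs_neighborhood hu).
  pose w' : {u | u \in neighborhood v2} := Sub w (nbrs_neighborhood hw).
  rewrite (bE u') (bE w') => /(opened_at_inj O1); rewrite !nbrs12 !tauK.
  by move=> /(_ hu hw)/val_inj/(can_inj tauK)/(congr1 val).
pose phi (x : plane) : plane := (x.1, - x.2).
have O2n : opened v2 S2 (fun x => - x.2) (fun u => (b2 u, 0)) n2.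
  apply: (@opened_ext _ _ _ _ _ (phi \o (fun u => (b2 u, 0)))).
    by move=> u _; rewrite /phi /= oppr0.
  apply: (@opened_map _ phi setT (fun x => - x.2) _ _ _ snd
            _ _ _ _ _ _ _ _ O2') => //.
  - move=> x _; apply: continuous_pair; first exact: cvg_fst.
    by apply: cvgN; exact: cvg_snd.
  - move=> x y _ _ [e1 /oppr_inj e2].
    by rewrite (surjective_pairing x) (surjective_pairing y) e1 e2.
  - by move=> x; rewrite /= opprK.
  - by move=> u _; rewrite /= !oppr0.
have Sinr2 (u : {u | u \in neighborhood v1}) : inr u \in S ->
    (exists2 e, e \in S1 & zip_left (inr u : zip_edge v1 v2) e) /\
    (exists2 e, e \in S2 & zip_right sigma (inr u) e).
  move=> /Sinr uS; split.
    by have /nbrsP[e eS eu] := uS; exists e => //=; rewrite eu.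
  by move: uS; rewrite nbrs12 => /nbrsP[e eS eu]; exists e => //=; rewrite eu.
apply: (drawn_zip (can_inj sigmaK) v1_simple v2_simple _ Sinr2 _ O1' O2n).
  move=> [[e|e]|u] fS.
  - by left; exists (val e); [exact: SS1|rewrite /=].
  - by right; exists (val e); [exact: SS2|rewrite /=].
  - by left; have [] := Sinr2 _ fS.
by move=> u; rewrite b12.
Qed.

End CrossingNumberOfZipProduct.

End CrossingsOfZipProducts.

Theorem theorem21 (R : realType) (G1 G2 : multigraph)
  (v1 : vertex G1) (v2 : vertex G2) (k1 k2 d : nat) (G : multigraph)
  (G1_no_deg2 : no_degree_two G1) (G2_no_deg2 : no_degree_two G2)
  (G1_critical : crossing_critical R k1 G1)
  (G2_critical : crossing_critical R k2 G2)
  (v1_simple : simple_vertex v1) (v2_simple : simple_vertex v2)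
  (v1_degree : degree v1 = d) (v2_degree : degree v2 = d)
  (homogeneous_nbhds : d <> 3 ->
     homogeneous_neighborhood v1 /\ homogeneous_neighborhood v2)
  (G_zip : zip_products v1 v2 G) :
  let k := maxn (crossing_number R G1 + k2) (crossing_number R G2 + k1) in
  k <= crossing_number R G -> crossing_critical R k G.
Proof.
move=> k k_le; split=> // f.
have [sigma sigma_bij GE] := G_zip; subst G.
have [k1_le critical1] := G1_critical; have [k2_le critical2] := G2_critical.
have free1 (S : {set edge G1}) :
    (forall e, v1 \notin ends e -> e \in S) -> free_vertex R v1 S.
  by apply: free_vertexP v1_simple v1_degree _ => /homogeneous_nbhds[].
have free2 (S : {set edge G2}) :
    (forall e, v2 \notin ends e -> e \in S) -> free_vertex R v2 S.
  by apply: free_vertexP v2_simple v2_degree _ => /homogeneous_nbhds[].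
have [tau sigmaK tauK] := sigma_bij.
have nbr (H : multigraph) (v : vertex H) (u : {u | u \in neighborhood v}) :
    exists e, ends e = [set val u; v]%SET.
  by have := valP u; rewrite finset.inE => /existsP[e /eqP]; exists e.
have nbrsT (H : multigraph) (v : vertex H) (u : {u | u \in neighborhood v}) :
    val u \in nbrs [set: edge H]%SET v.
  by have [e eu] := nbr _ _ u; apply/nbrsP; exists e; rewrite ?finset.inE.
have nbrsC (H : multigraph) (v : vertex H) (u : {u | u \in neighborhood v})
    (e : edge H) : v \notin ends e -> val u \in nbrs [set~ e]%SET v.
  move=> ve; have [e' eu] := nbr _ _ u; apply/nbrsP; exists e' => //.
  rewrite !finset.inE; apply: contraNneq ve => <-.
  by rewrite eu !finset.inE eqxx orbT.
have draw n : drawn R [set~ f]%SET n ->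
    (crossing_number R (del_edge f) <= n)%N.
  by move=> D; apply: crossing_number_le; exact: del_edge_drawn.
have drawT H := @drawn_crossing_number R H.
have drawC (H : multigraph) (e : edge H) :=
  drawn_del_edge (drawT (del_edge e)).
case: f draw => [[e|e]|u] draw.
- have e_lt := critical1 (val e).
  have D := drawn_zip_free v1_simple v2_simple sigma_bij
    (S := [set~ inl (inl e)]%SET) _ _ _ _ _ (drawC _ (val e)) (drawT G2).
  apply: leq_ltn_trans (draw _ (D _ _ _ _ _)) _.
  + move=> e'; rewrite !finset.inE; apply: contra_neq.
    by move/val_inj ->.
  + by move=> e' _; rewrite finset.inE.
  + by move=> u _; apply: nbrsC; exact: valP e.
  + by move=> u; rewrite nbrsT nbrsC //; exact: valP e.
  + by right; apply: free2 => e' _; rewrite finset.inE.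
  + by rewrite /k leq_max; apply/orP; right; rewrite addnC ltn_add2l.
- have e_lt := critical2 (val e).
  have D := drawn_zip_free v1_simple v2_simple sigma_bij
    (S := [set~ inl (inr e)]%SET) _ _ _ _ _ (drawT G1) (drawC _ (val e)).
  apply: leq_ltn_trans (draw _ (D _ _ _ _ _)) _.
  + by move=> e' _; rewrite finset.inE.
  + move=> e'; rewrite !finset.inE; apply: contra_neq.
    by move/val_inj ->.
  + by move=> u _; exact: nbrsT.
  + by move=> u; rewrite nbrsT nbrsC //; exact: valP e.
  + by left; apply: free1 => e' _; rewrite finset.inE.
  + by rewrite /k leq_max; apply/orP; left; rewrite ltn_add2l.
have [e1 e1u] := nbr _ _ u; have [e2 e2u] := nbr _ _ (sigma u).
have nbrs_u (H : multigraph) (v : vertex H) (w w' : {u | u \in neighborhood v})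
    (e : edge H) : simple_vertex v -> ends e = [set val w; v]%SET ->
    (val w' \in nbrs [set~ e]%SET v) = (w' != w).
  move=> v_simple ew; apply/nbrsP/idP => [[e' + ew']|w'w].
    rewrite !finset.inE; apply: contra_neq => w'w; apply: v_simple.
      by rewrite ew' !finset.inE eqxx orbT.
    by rewrite ew ew' w'w.
  have [e' ew'] := nbr _ _ w'; exists e' => //; rewrite !finset.inE.
  by apply: contra_neq w'w => e'e; apply: nbr_set2_inl ew' _; rewrite e'e.
have D := drawn_zip_free v1_simple v2_simple sigma_bij
  (S := [set~ inr u]%SET) _ _ _ _ _ (drawC _ e1) (drawC _ e2).
apply: leq_ltn_trans (draw _ (D _ _ _ _ _)) _.
- move=> e _; rewrite !finset.inE; apply: contraNneq (valP e) => /= ->.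
  by rewrite e1u !finset.inE eqxx orbT.
- move=> e _; rewrite !finset.inE; apply: contraNneq (valP e) => /= ->.
  by rewrite e2u !finset.inE eqxx orbT.
- move=> w; rewrite (nbrs_u _ _ _ _ _ v1_simple e1u) !finset.inE.
  by apply: contra_neq => ->.
- move=> w; rewrite (nbrs_u _ _ _ _ _ v1_simple e1u).
  by rewrite (nbrs_u _ _ _ _ _ v2_simple e2u) (can_eq sigmaK).
- left; apply: free1 => e ve; rewrite !finset.inE; apply: contraNneq ve => ->.
  by rewrite e1u !finset.inE eqxx orbT.
have e1_lt := critical1 e1; have e2_lt := critical2 e2.
rewrite /k leq_max; apply/orP; left.
have e1_le := ltnW (leq_trans e1_lt k1_le).
by apply: leq_ltn_trans (leq_add e1_le (leqnn _)) _; rewrite ltn_add2l.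
Qed.
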